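(* Let $\mathcal D$ be a distribution on $\mathcal X\times\{0,1\}$, where $\mathcal X=\{x\in\mathbb R^d:\|x\|_2\le1,\ x_1=\frac12\}$. Let $p\sim\pi$ be the randomized predictor learned by the online-to-batch reduction described in the context: the Blum–Mansour/Online-Newton-Step forecaster $\mathcal A$ with discretization parameter $N=(T/d)^{1/5}$ is run on $T$ i.i.d. samples from $\mathcal D$. With probability at least $1-\delta$, this randomized predictor satisfies $$\mathsf{SAErr}_{\mathcal F_4^{\mathrm{lin}}}=\tilde{\mathcal O}\left(\left(\frac dT\right)^{\frac25}+\left(\frac dT\right)^{\frac25}\sqrt{\log\frac1\delta}\right).$$ Consequently, $\tilde\Omega(d\,\varepsilon^{-2.5})$ samples are sufficient for $p$ to achieve a swap agnostic error at most $\varepsilon$. Here $\tilde{\mathcal O},\tilde\Omega$ hide lower-order logarithmic terms.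
   Context: Forecaster $\mathcal A$ (with parameter $N$, rounded to a positive integer). Let $z_i=i/N$ and $\mathcal Z=\{z_0,\dots,z_N\}$. For each $i\in\{0,\dots,N\}$ maintain a vector $\theta_{t,i}$ in the ball $4\mathbb B=\{\theta\in\mathbb R^d:\|\theta\|_2\le4\}$, with $\theta_{1,i}$ arbitrary. In round $t$, given the context $x_t\in\mathcal X$: (1) set $w_{t,i}=\mathrm{Proj}_{[0,1]}(\langle\theta_{t,i},x_t\rangle)$; (2) let $\boldsymbol q_{t,i}$ be the distribution on $\mathcal Z$ supported on the two neighbouring grid points $z_j\le w_{t,i}<z_{j+1}$, with masses $N(z_{j+1}-w_{t,i})$ and $N(w_{t,i}-z_j)$ respectively (all mass on $1$ if $w_{t,i}=1$); (3) let $Q_t$ be the matrix with columns $\boldsymbol q_{t,0},\dots,\boldsymbol q_{t,N}$ and compute a probability vector $\boldsymbol p_t=(p_{t,0},\dots,p_{t,N})$ with $Q_t\boldsymbol p_t=\boldsymbol p_t$; (4) predict by sampling from $\mathcal P_t$, where $\mathcal P_t(z_i)=p_{t,i}$, then observe $y_t\in\{0,1\}$; (5) for each $i$, perform an Online Newton Step for the loss $\phi_{t,i}(\theta)=p_{t,i}(\langle\theta,x_t\rangle-y_t)^2$: with $\beta=\frac1{640}$, $\omega=\frac1{4\beta^2}$, $\nabla_{\tau,i}=\nabla\phi_{\tau,i}(\theta_{\tau,i})$ and $A_{t,i}=\sum_{\tau\le t}\nabla_{\tau,i}\nabla_{\tau,i}^\top+\omega I_d$, let $\theta_{t+1,i}$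 be the minimizer over $\theta\in4\mathbb B$ of $(u-\theta)^\top A_{t,i}(u-\theta)$, where $u=\theta_{t,i}-\frac1\beta A_{t,i}^{-1}\nabla_{t,i}$. Online-to-batch reduction. Draw $(x_1,y_1),\dots,(x_T,y_T)$ i.i.d. from $\mathcal D$ and feed them in order to $\mathcal A$. The state of $\mathcal A$ before round $t$, together with fresh internal randomness independent of the samples, defines a predictor $p_t:\mathcal X\to\mathcal Z$: for each $x$, $p_t(x)$ is distributed as the prediction $\mathcal A$ would make in round $t$ on context $x$; the actual prediction in round $t$ is $p_t(x_t)$. Let $\pi$ be the uniform distribution over $p_1,\dots,p_T$; the randomized predictor is $p\sim\pi$. The probability in the claim is over the samples and the internal randomness producing $p_1,\dots,p_T$. Function class. $\mathcal F^{\mathrm{lin}}=\{x\mapsto\langle\theta,x\rangle:\theta\in\mathbb R^d\}$ and $\mathcal F_4^{\mathrm{lin}}=\{f\in\mathcal F^{\mathrm{lin}}:f(x)^2\le4\text{ for all }x\in\mathcal X\}$. Swap agnostic error (squared loss) of the randomized predictor: $$\mathsf{SAErr}_{\mathcal F}=\sup_{\{f_v\in\mathcal F\}_{v\in\mathcal Z}}\mathbb E_{(x,y)\sim\mathcal D,\ p\sim\pi}\Big[(p(x)-y)^2-(f_{p(x)}(x)-y)^2\Big],$$ with $(x,y)$ a fresh draw, independent of $p_1,\dots,p_T$ and of the choice $p\sim\pi$. *)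

(* Defs.v *)
From HB Require Import structures.
From mathcomp Require Import all_boot all_order all_algebra.
From mathcomp Require Import all_classical all_reals all_analysis.
Set Implicit Arguments.
Unset Strict Implicit.
Unset Printing Implicit Defensive.
Import Order.TTheory GRing.Theory Num.Theory.
Import numFieldNormedType.Exports.
Local Open Scope classical_set_scope.
Local Open Scope ring_scope.

(* Points of R^d on which measures live are d-tuples, which carry the product
   sigma-algebra; [vec] moves them to column vectors for linear algebra. *)
Notation sample R d := (d.-tuple R * bool)%type.

Section Euclidean.
Variables (R : realType) (d : nat).

Definition vec (x : d.-tuple R) : 'cV[R]_d := \col_j tnth x j.

Definition dot (u v : 'cV[R]_d) : R := (u^T *m v) 0 0.

(* The norm [`|u|] that the library puts on matrices is the sup norm. *)
Definition enorm (u : 'cV[R]_d) : R := Num.sqrt (dot u u).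

Definition contexts : set (d.-tuple R) :=
  [set x | enorm (vec x) <= 1 /\
           forall j : 'I_d, j = 0%N :> nat -> tnth x j = 2^-1].

Definition ball4 : set 'cV[R]_d := [set theta | enorm theta <= 4].

Definition gradient (f : 'cV[R]_d -> R) (a : 'cV[R]_d) : 'cV[R]_d :=
  \col_j 'D_(delta_mx j 0) f a.

Definition Flin : set (d.-tuple R -> R) :=
  [set f | exists theta : 'cV[R]_d, f = fun x => dot theta (vec x)].

Definition Flin4 : set (d.-tuple R -> R) :=
  [set f | Flin f /\ forall x, contexts x -> (f x) ^+ 2 <= 4].

End Euclidean.

Section Forecaster.
Variables (R : realType) (d N : nat).

Definition grid (i : nat) : R := i%:R / N%:R.

Definition proj01 (r : R) : R := Num.max 0 (Num.min 1 r).

Definition rounding (w : R) : 'cV[R]_N.+1 :=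
  \col_k (if w == 1 then (k == N :> nat)%:R
          else if grid k <= w < grid k.+1 then N%:R * (grid k.+1 - w)
          else if grid k.-1 <= w < grid k then N%:R * (w - grid k.-1)
          else 0).

Definition rounding_mx (theta : 'I_N.+1 -> 'cV[R]_d) (x : d.-tuple R) :
    'M[R]_N.+1 :=
  \matrix_(k, i) rounding (proj01 (dot (theta i) (vec x))) k 0.

Definition is_distr (p : 'cV[R]_N.+1) : Prop :=
  (forall i, 0 <= p i 0) /\ \sum_i p i 0 = 1.

Definition beta : R := 640^-1.
Definition omega : R := (4 * beta ^+ 2)^-1.

Definition loss (p : R) (x : d.-tuple R) (y : bool) (theta : 'cV[R]_d) : R :=
  p * (dot theta (vec x) - y%:R) ^+ 2.

Definition quad (A : 'M[R]_d) (v : 'cV[R]_d) : R := (v^T *m A *m v) 0 0.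

Definition argmin4 (f : 'cV[R]_d -> R) : 'cV[R]_d :=
  xget 0 [set theta | ball4 theta /\
                      forall theta', ball4 theta' -> f theta <= f theta'].

(* Maps (theta_{t,i}, A_{t-1,i}) to (theta_{t+1,i}, A_{t,i}). *)
Definition ons_step (p : R) (x : d.-tuple R) (y : bool)
    (st : 'cV[R]_d * 'M[R]_d) : 'cV[R]_d * 'M[R]_d :=
  let g := gradient (loss p x y) st.1 in
  let A := st.2 + g *m g^T in
  let u := st.1 - beta^-1 *: (invmx A *m g) in
  (argmin4 (fun theta => quad A (u - theta)), A).

(* Histories list the past samples most recent first.  [weights h x] is the
   vector p_t computed after history [h] on context [x]; the fixed point of Q_t
   need not be unique, so the choice made by the forecaster is a parameter. *)
Fixpoint state (theta1 : 'I_N.+1 -> 'cV[R]_d)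
    (weights : seq (sample R d) -> d.-tuple R -> 'cV[R]_N.+1)
    (h : seq (sample R d)) : 'I_N.+1 -> 'cV[R]_d * 'M[R]_d :=
  if h is (x, y) :: h' then
    fun i => ons_step (weights h' x i 0) x y (state theta1 weights h' i)
  else fun i => (theta1 i, omega%:M).

Definition is_forecaster (theta1 : 'I_N.+1 -> 'cV[R]_d)
    (weights : seq (sample R d) -> d.-tuple R -> 'cV[R]_N.+1) : Prop :=
  (forall i, ball4 (theta1 i)) /\
  forall h x, contexts x ->
    let Q := rounding_mx (fun i => (state theta1 weights h i).1) x in
    is_distr (weights h x) /\ Q *m weights h x = weights h x.

(* [pred h e x] is (the index in the grid of) the prediction on context [x]
   after history [h] when the fresh internal randomness, of law [rho], takes the
   value [e].  How predictions on different contexts are coupled through [e] is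
   left free; joint measurability makes the expectations below meaningful. *)
Definition is_sampler (weights : seq (sample R d) -> d.-tuple R -> 'cV[R]_N.+1)
    (dE : measure_display) (E : measurableType dE) (rho : probability E R)
    (pred : seq (sample R d) -> E -> d.-tuple R -> 'I_N.+1) : Prop :=
  (forall (n : nat) (i : 'I_N.+1),
     measurable [set z : n.-tuple (sample R d) * E * d.-tuple R |
                   pred z.1.1 z.1.2 z.2 = i]) /\
  forall h x i, contexts x ->
    rho [set e | pred h e x = i] = (weights h x i 0)%:E.

End Forecaster.

Section Probability.
Variables (R : realType) (dO : measure_display) (Omega : measurableType dO).
Variable P : probability Omega R.

Definition mutually_independent (I : finType) (G : I -> set_system Omega) :
    Prop :=
  forall (J : {set I}) (A : I -> set Omega),
    (forall i, i \in J -> G i (A i)) ->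
    P (\bigcap_(i in [set` J]) A i) = (\prod_(i in J) fine (P (A i)))%:E.

Definition iid_fresh (T : nat) (d1 d2 : measure_display)
    (U : measurableType d1) (E : measurableType d2)
    (D : probability U R) (rho : probability E R)
    (S : 'I_T -> {RV P >-> U}) (r : 'I_T -> {RV P >-> E}) : Prop :=
  [/\ forall t A, measurable A -> distribution P (S t) A = D A,
      forall t A, measurable A -> distribution P (r t) A = rho A &
      mutually_independent (fun s : 'I_T + 'I_T =>
        match s with
        | inl t => preimage_set_system setT (S t) measurable
        | inr t => preimage_set_system setT (r t) measurable
        end)].

(* The event [B] is not assumed measurable: it is required to contain a
   measurable event of probability at least [1 - delta]. *)
Definition with_prob_ge (q : R) (B : set Omega) : Prop :=
  exists G : set Omega,
    [/\ measurable G, G `<=` B & (q%:E <= P G)%E].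

End Probability.

Section SwapError.
Variables (R : realType) (d N T : nat).

(* The predictors p_1, ..., p_T run along the sample path [S]. *)
Definition predictors (E : Type)
    (pred : seq (sample R d) -> E -> d.-tuple R -> 'I_N.+1)
    (S : 'I_T -> sample R d) (r : 'I_T -> E) (t : 'I_T) :
    d.-tuple R -> 'I_N.+1 :=
  pred [seq S s | s : 'I_T <- rev (enum 'I_T) & (s < t)%N] (r t).

(* Swap agnostic error of the uniform mixture of p_1, ..., p_T; the average over
   [t] is the expectation over the choice of the predictor. *)
Definition SAErr (F : set (d.-tuple R -> R))
    (D : probability (sample R d) R) (p : 'I_T -> d.-tuple R -> 'I_N.+1) :
    \bar R :=
  ereal_sup [set e | exists2 f : 'I_N.+1 -> d.-tuple R -> R,
    (forall v, F (f v)) &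
    e = ('E_D[(fun z => T%:R^-1 * \sum_(t < T)
                ((grid R N (p t z.1) - z.2%:R) ^+ 2
                 - (f (p t z.1) z.1 - z.2%:R) ^+ 2))%R])%E].

(* [N] is [a] rounded (up, down or to nearest) to a positive integer. *)
Definition rounds_to (a : R) : Prop := (0 < N)%N /\ `|N%:R - a| < 1.

End SwapError.

(* Main.v *)
(* Blum-Mansour: since [Q_t p_t = p_t], averaging over the prediction averages
   the rounded expert predictions, so the swap regret of the forecaster is at
   most the sum of the regrets of its [N + 1] experts plus a rounding loss
   [1/(4 N^2)] per round.  Each expert runs Online Newton Step on losses that
   are exp-concave on the ball of radius 4, and the matrix determinant lemma
   telescopes its regret to [O(d log T)], uniformly in the sample path.  To
   pass from regret to risk, fix a comparator [f] in a net of size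
   [M ^ (d (N + 1))]: the difference between its conditional risk and its loss
   in the round is a bounded martingale difference, so Azuma's inequality and a
   union bound over the net cost [sqrt ((N d log T + log (1/delta)) / T)].
   Finally [F_4^lin] is contained in the predictors [x |-> <theta, x>] with
   [theta] in the ball of radius 4, because [x_1 = 1/2] on contexts leaves room
   for every other direction. *)

Require Import Defs.
From HB Require Import structures.
From mathcomp Require Import all_boot all_order all_fingroup all_algebra.
From mathcomp Require Import ring lra.
From mathcomp Require Import all_classical all_reals all_analysis.
From mathcomp Require Import measurable_realfun.
Import Order.TTheory GRing.Theory Num.Theory.
Import numFieldNormedType.Exports.
Local Open Scope classical_set_scope.
Local Open Scope ring_scope.

Set Implicit Arguments.
Unset Strict Implicit.
Unset Printing Implicit Defensive.

(** * Projections onto the ball and gradients of the losses *)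

(** The forecaster is updated with the weights only, never with a sampled prediction, so the regret
    bound holds for weighted losses on every sample path and involves no probability. Randomness
    enters once per round, through the pair of sample and internal randomness, and a single
    martingale pays for both: the risk under a fresh sample with the drawn randomness kept, minus
    the loss at the observed sample averaged over the randomness. Two obstacles shape the rest. One
    event of high probability has to serve a continuum of comparators: the martingale is controlled
    at net points, the regret bound is used at the comparator itself. And samples are contexts only
    almost surely, whereas linear functions are unbounded elsewhere: losses are cut off there and a
    null event is discarded. The deviation is of order [sqrt (N d / T)] and the rounding loss of
    order [1 / N^2]; they balance at [N^5 = T / d], which explains the exponents 1/5 and 2/5. *)

Section Dot.
Context {R : realType} {d : nat}.
Implicit Types (u v w x : 'cV[R]_d) (A : 'M[R]_d).

Lemma dotE u v : dot u v = \sum_j u j 0 * v j 0.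
Proof. by rewrite /dot mxE; apply: eq_bigr => j _; rewrite mxE. Qed.

Lemma dotC u v : dot u v = dot v u.
Proof. by rewrite !dotE; apply: eq_bigr => j _; rewrite mulrC. Qed.

Lemma dotDr u v w : dot u (v + w) = dot u v + dot u w.
Proof. by rewrite /dot mulmxDr mxE. Qed.

Lemma dotZr (a : R) u v : dot u (a *: v) = a * dot u v.
Proof. by rewrite /dot -scalemxAr mxE. Qed.

Lemma dotDl u v w : dot (u + v) w = dot u w + dot v w.
Proof. by rewrite dotC dotDr !(dotC w). Qed.

Lemma dotZl (a : R) u v : dot (a *: u) v = a * dot u v.
Proof. by rewrite dotC dotZr dotC. Qed.

Lemma dotNr u v : dot u (- v) = - dot u v.
Proof. by rewrite -scaleN1r dotZr mulN1r. Qed.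

Lemma dotNl u v : dot (- u) v = - dot u v.
Proof. by rewrite dotC dotNr dotC. Qed.

Definition dot_lin := (dotDl, dotDr, dotNl, dotNr, dotZl, dotZr).

Lemma dot_ge0 u : 0 <= dot u u.
Proof. by rewrite dotE sumr_ge0// => j _; rewrite -expr2 sqr_ge0. Qed.

Lemma dot_gt0 u : u != 0 -> 0 < dot u u.
Proof.
move=> u0; rewrite lt_def dot_ge0 andbT; apply: contra u0 => /eqP.
rewrite dotE => /eqP; rewrite psumr_eq0 => [/allP u0|j _]; last first.
  by rewrite -expr2 sqr_ge0.
apply/eqP/colP => j; rewrite mxE; apply/eqP.
by have := u0 j (mem_index_enum j); rewrite -expr2 sqrf_eq0.
Qed.

Lemma enorm_le (a : R) u : 0 <= a -> (enorm u <= a) = (dot u u <= a ^+ 2).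
Proof.
move=> a0; rewrite /enorm -[in LHS](ger0_norm a0) -sqrtr_sqr.
by rewrite ler_sqrt// sqr_ge0.
Qed.

Lemma ball4E u : ball4 u <-> dot u u <= 16.
Proof. by rewrite /ball4/= enorm_le// (_ : 4 ^+ 2 = 16)//; ring. Qed.

Lemma context_dot_le (t : d.-tuple R) : contexts t -> dot (vec t) (vec t) <= 1.
Proof. by case=> + _; rewrite enorm_le// expr1n. Qed.

Lemma coord_norm_le1 u (j : 'I_d) : dot u u <= 1 -> `|u j 0| <= 1.
Proof.
rewrite dotE (bigD1 j)//= -expr2 => h.
have s0 : 0 <= \sum_(i < d | i != j) u i 0 * u i 0.
  by rewrite sumr_ge0// => i _; rewrite -expr2 sqr_ge0.
rewrite -(ler_pXn2r (n := 2))// ?nnegrE// expr1n real_normK ?num_real//; lra.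
Qed.

Lemma dot_ball4_le4 u x : ball4 u -> dot x x <= 1 -> `|dot u x| <= 4.
Proof.
move=> /ball4E u16 x1.
(* Cauchy-Schwarz with the scaling built in: the squares of [u - 4 *: x] and [u + 4 *: x] bound 8
   times the inner product by 16 + 16. *)
have := dot_ge0 (u - 4 *: x); have := dot_ge0 (u + 4 *: x).
rewrite !dot_lin (dotC x u) ler_norml => h1 h2; apply/andP; split; lra.
Qed.

Lemma ball4_conv (s : R) u v : 0 <= s <= 1 -> ball4 u -> ball4 v ->
  ball4 (u + s *: (v - u)).
Proof.
move=> /andP[s0 s1] /ball4E bu /ball4E bv; apply/ball4E.
have := dot_ge0 (u - v); rewrite !dot_lin (dotC v u) => h.
have s01 : 0 <= s * (1 - s) by rewrite mulr_ge0// subr_ge0.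
have := mulr_ge0 s01 h; have := mulr_ge0 s0 (_ : 0 <= 16 - dot v v).
rewrite subr_ge0 => /(_ bv) h2.
have := mulr_ge0 (_ : 0 <= 1 - s) (_ : 0 <= 16 - dot u u).
rewrite !subr_ge0 => /(_ s1 bu) h3 h4; nra.
Qed.

Lemma quadE A v : quad A v = dot v (A *m v).
Proof. by rewrite /quad /dot mulmxA. Qed.

Lemma dot_mulmx A u v : A^T = A -> dot u (A *m v) = dot v (A *m u).
Proof.
move=> As; by rewrite dotC /dot trmx_mul As -mulmxA.
Qed.

Lemma quadD A u v : A^T = A ->
  quad A (u + v) = quad A u + 2 * dot u (A *m v) + quad A v.
Proof.
move=> As; rewrite !quadE mulmxDr !dot_lin (dot_mulmx v u As); ring.
Qed.

Lemma quadZ A (a : R) v : quad A (a *: v) = a ^+ 2 * quad A v.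
Proof. by rewrite !quadE -scalemxAr !dot_lin mulrA. Qed.

Lemma quadN A v : quad A (- v) = quad A v.
Proof. by rewrite -scaleN1r quadZ sqrrN expr1n mul1r. Qed.

Lemma quad_scalar (a : R) v : quad a%:M v = a * dot v v.
Proof. by rewrite quadE mul_scalar_mx dotZr. Qed.

Lemma mul_col_dot u v w : u *m v^T *m w = dot v w *: u.
Proof.
rewrite -mulmxA [v^T *m w](mx11_scalar _) -/(dot v w).
by rewrite mul_mx_scalar.
Qed.

Lemma quad_rank1 A g v : quad (A + g *m g^T) v = quad A v + dot g v ^+ 2.
Proof. by rewrite !quadE mulmxDl mul_col_dot !dot_lin (dotC v g) expr2. Qed.

End Dot.

(** * Existence of the minimizer and the Pythagorean inequality *)

Section Argmin.
Context {R : realType} {d : nat}.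

Lemma continuous_sum_coord (n : nat) (F : 'I_n -> 'cV[R]_d -> R) :
  (forall i, continuous (F i)) -> continuous (fun v => \sum_i F i v).
Proof.
move=> cF; elim: n F cF => [|n ih] F cF.
  rewrite (_ : (fun _ => _) = cst 0); first exact: cst_continuous.
  by apply/funext => v; rewrite big_ord0.
rewrite (_ : (fun _ => _) = (fun v => F ord0 v + \sum_i F (lift ord0 i) v)).
  by move=> v; apply: continuousD; [exact: cF|apply: ih => i; exact: cF].
by apply/funext => v; rewrite big_ord_recl.
Qed.

Lemma continuous_dot (f g : 'cV[R]_d -> 'cV[R]_d) :
  (forall i, continuous (fun v => f v i 0)) ->
  (forall i, continuous (fun v => g v i 0)) ->
  continuous (fun v => dot (f v) (g v)).
Proof.
move=> cf cg; rewrite (_ : (fun _ => _) = fun v => \sum_j f v j 0 * g v j 0).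
  by apply: continuous_sum_coord => i v; apply: continuousM; [exact: cf|exact: cg].
by apply/funext => v; rewrite dotE.
Qed.

(** Heine-Borel is applied to row vectors, and transposition, continuous for the sup norm, carries
    compactness over to columns. *)
Lemma ball4_compact : compact (@ball4 R d).
Proof.
pose tr (v : 'rV[R]_d) : 'cV[R]_d := v^T.
have ctr : continuous tr.
  move=> v B /nbhs_ballP[e e0 eB]; apply/nbhs_ballP; exists e => //= w [_ vw].
  by apply: eB; split => // i j; rewrite !mxE; exact: vw.
have -> : @ball4 R d = tr @` [set v | ball4 (tr v)].
  apply/seteqP; split => [v bv|v [w bw <-]]//=.
  by exists v^T; rewrite /tr/= trmxK.
apply: continuous_compact; first exact: continuous_subspaceT.
apply: bounded_closed_compact.
- exists 4; split => // M M4 v bv; apply: le_trans (ltW M4).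
  rewrite [leLHS]/Num.norm /= mx_normrE; apply/bigmax_leP; split => // -[i j] _ /=.
  move: bv => /= /ball4E; rewrite dotE (bigD1 j)//= -expr2 /tr mxE.
  have s0 : 0 <= \sum_(i < d | i != j) v^T i 0 * v^T i 0.
    by rewrite sumr_ge0// => k _; rewrite -expr2 sqr_ge0.
  move=> h; rewrite (ord1 i).
  rewrite -(ler_pXn2r (n := 2))// ?nnegrE// real_normK ?num_real//.
  have : (4 : R) ^+ 2 = 16 by ring.
  move=> ->; lra.
- rewrite (_ : mkset _ = (fun v => dot (tr v) (tr v)) @^-1` [set x | x <= 16]).
    apply: closed_comp; last exact: closed_le.
    move=> v _; apply: (@continuous_comp _ _ _ tr (fun w => dot w w)).
      exact: ctr.
    by apply: continuous_dot => i w; exact: coord_continuous.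
  by apply/seteqP; split => v /= /ball4E.
Qed.

Lemma argmin4P (A : 'M[R]_d) (u : 'cV[R]_d) :
  let t := argmin4 (fun theta => quad A (u - theta)) in
  ball4 t /\ forall t', ball4 t' -> quad A (u - t) <= quad A (u - t').
Proof.
(* [xget] falls back to 0 when there is no minimizer; the extreme value theorem rules that case
   out. *)
move=> t; rewrite /t /argmin4; case: xgetP => [x _ //|h0].
have cq : continuous (fun theta : 'cV[R]_d => quad A (u - theta)).
  rewrite (_ : (fun _ => _) = fun v : 'cV[R]_d => dot (u - v) (A *m (u - v))); last first.
    by apply/funext => v; rewrite quadE.
  have cu i : continuous (fun v : 'cV[R]_d => (u - v) i 0).
    rewrite (_ : (fun _ => _) = fun v : 'cV[R]_d => u i 0 - v i 0); last first.
      by apply/funext => v; rewrite !mxE.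
    by move=> v; apply: continuousB; [exact: cst_continuous|exact: coord_continuous].
  apply: continuous_dot => // i.
  rewrite (_ : (fun _ => _) = fun v : 'cV[R]_d => \sum_j A i j * (u - v) j 0); last first.
    by apply/funext => v; rewrite mxE.
  apply: continuous_sum_coord => j v.
  by apply: continuousM; [exact: cst_continuous|exact: cu].
have b0 : @ball4 R d !=set0.
  exists 0; apply/ball4E.
  by rewrite dotE big1// => i _; rewrite mxE mul0r.
have [c cb cmin] := @compact_EVT_min _ _ _ _ b0 ball4_compact
  (@continuous_subspaceT _ _ _ _ cq).
exfalso; apply: (h0 c); split; first by rewrite inE in cb.
by move=> t' bt'; apply: cmin; rewrite inE.
Qed.

(** First-order optimality of the projection [t] makes the angle term [B] nonpositive, so expanding
    the square around [t] leaves only nonnegative terms besides the left-hand side. *)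
Lemma projection_le (A : 'M[R]_d) (u : 'cV[R]_d) (w : 'cV[R]_d) :
  A^T = A -> (forall v, 0 <= quad A v) -> ball4 w ->
  let t := argmin4 (fun theta => quad A (u - theta)) in
  quad A (t - w) <= quad A (u - w).
Proof.
move=> As A0 bw /=; set t := argmin4 _; have [bt tmin] := argmin4P A u.
rewrite -/t in bt tmin.
set B := dot (u - t) (A *m (w - t)); set Q := quad A (w - t).
have Q0 : 0 <= Q by exact: A0.
have key s : 0 <= s <= 1 -> 2 * s * B <= s ^+ 2 * Q.
  move=> s01; have := tmin _ (ball4_conv s01 bt bw).
  have -> : u - (t + s *: (w - t)) = (u - t) + (- s) *: (w - t).
    by rewrite opprD addrA scaleNr.
  rewrite [leRHS]quadD// quadZ -scalemxAr dotZr -/B -/Q sqrrN => h; lra.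
have B0 : B <= 0.
  rewrite leNgt; apply/negP => Bp.
  have BQ : 0 < B + Q by lra.
  (* The step [s = B / (B + Q)] lies in [0, 1] even when [Q = 0], and turns the inequality into
     [2 B <= s Q = B - s B], which is absurd. *)
  have := key (B / (B + Q)); rewrite ler_pdivrMr// mul1r lerDl Q0 andbT.
  rewrite divr_ge0 ?(ltW Bp) ?(ltW BQ)// => /(_ erefl).
  set s := B / (B + Q) => h.
  have s0 : 0 < s by rewrite divr_gt0.
  have sBQ : s * (B + Q) = B by rewrite /s divfK// gt_eqF.
  have h' : 2 * B <= s * Q by rewrite -(ler_pM2l s0); move: h; rewrite expr2; lra.
  have : 0 < s * B by rewrite mulr_gt0.
  lra.
have -> : u - w = (u - t) + (- (w - t)) by rewrite opprB addrA subrK.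
rewrite -(opprB w t) quadN quadD// mulmxN dotNr -/B quadN -/Q.
have := A0 (u - t); lra.
Qed.

End Argmin.

Section Gradient.
Context {R : realType} {d : nat}.

Lemma gradient_loss (p : R) (x : d.-tuple R) (y : bool) (a : 'cV[R]_d) :
  gradient (loss p x y) a = (2 * p * (dot a (vec x) - y%:R)) *: vec x.
Proof.
apply/colP => j; rewrite !mxE /derive.
set c := dot a (vec x) - y%:R; set m := tnth x j.
apply: cvg_lim => //.
(* The summand [0 * m ^+ 2] displays the derivative as the value at [h = 0] of the difference
   quotient, a polynomial in [h]. *)
have -> : 2 * p * c * m = p * (2 * c * m + 0 * m ^+ 2) by ring.
have : (fun h : R => p * (2 * c * m + h * m ^+ 2)) @ 0^' -->
    p * (2 * c * m + 0 * m ^+ 2).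
  apply: cvg_within_filter.
  apply: cvgM; first exact: cvg_cst.
  apply: cvgD; first exact: cvg_cst.
  by apply: cvgM; [exact: cvg_id|exact: cvg_cst].
apply: cvg_trans; apply: near_eq_cvg; near=> h.
have h0 : h != 0 by near: h; exact: nbhs_dnbhs_neq.
have e : dot (delta_mx j 0) (vec x) = m.
  rewrite dotE (bigD1 j)//= big1 => [|i ij]; last first.
    by rewrite !mxE (negbTE ij) mul0r.
  by rewrite !mxE !eqxx mul1r addr0.
rewrite /loss/= /shift/= /GRing.scale/= !dot_lin e.
rewrite -/c -addrA -/c.
have -> : p * (h * m + c) ^+ 2 - p * c ^+ 2 = h * (p * (2 * c * m + h * m ^+ 2)).
  ring.
by rewrite mulKf.
Unshelve. all: by end_near.
Qed.

End Gradient.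

(** * The Online Newton Step and swap regret along a sample path *)

Section RankOne.
Context {R : realType} {d : nat}.
Implicit Types (A : 'M[R]_d) (g : 'cV[R]_d).

(** The bordered matrix with blocks [A], [- g], [g^T], [1] becomes block triangular in two ways,
    clearing its lower left block from the right or from the left; the two determinants are
    compared. *)
Lemma det_rank1 A g : A \in unitmx ->
  \det (A + g *m g^T) = \det A * (1 + dot g (invmx A *m g)).
Proof.
move=> Au.
have e1 : block_mx A (- g) g^T 1%:M *m block_mx 1%:M 0 (- g^T) 1%:M
    = block_mx (A + g *m g^T) (- g) 0 (1%:M : 'M[R]_1).
  rewrite mulmx_block !mulmx1 !mulmx0 !mul1mx !add0r.
  by rewrite mulNmx mulmxN opprK subrr.
have e2 : block_mx 1%:M 0 (- (g^T *m invmx A)) 1%:M *m block_mx A (- g) g^T 1%:M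
    = block_mx A (- g) 0 ((1 + dot g (invmx A *m g))%:M : 'M[R]_1).
  rewrite mulmx_block !mul1mx !mul0mx !addr0.
  rewrite !mulNmx mulmxN opprK -!mulmxA mulVmx// mulmx1 addNr.
  congr block_mx; rewrite [g^T *m _](mx11_scalar _) -/(dot _ _).
  by rewrite -raddfD/= addrC.
have := congr1 determinant e1; have := congr1 determinant e2.
rewrite !det_mulmx !det_ublock !det_lblock !det1 !mul1r !mulr1 => -> <-.
by rewrite det_scalar1.
Qed.

Lemma unitmx_coercive A (a : R) : 0 < a ->
  (forall v, a * dot v v <= quad A v) -> A \in unitmx.
Proof.
move=> a0 qA; rewrite -unitmx_tr -row_free_unit; apply: inj_row_free => v vA.
apply/eqP/negPn/negP => v0.
have v0' : v^T != 0 by apply: contra v0 => /eqP/(congr1 trmx); rewrite trmxK trmx0 => ->.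
have := qA v^T; rewrite quadE.
have -> : A *m v^T = 0 by rewrite -[LHS]trmxK trmx_mul trmxK vA trmx0.
by rewrite leNgt -(scale0r v^T) dotZr mul0r mulr_gt0// dot_gt0.
Qed.

Lemma invmx_quad_ge0 A g : A \in unitmx -> (forall v, 0 <= quad A v) ->
  0 <= dot g (invmx A *m g).
Proof.
move=> Au /(_ (invmx A *m g)); rewrite quadE mulmxA mulmxV// mul1mx.
by rewrite dotC.
Qed.

(* Sherman-Morrison turns the left-hand side into s/(1+s), and the determinant
   ratio is 1+s. *)
Lemma elliptic_potential_step A g : A \in unitmx -> A + g *m g^T \in unitmx ->
  0 < \det A -> (forall v, 0 <= quad A v) ->
  dot g (invmx (A + g *m g^T) *m g) <=
    ln (\det (A + g *m g^T)) - ln (\det A).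
Proof.
move=> Au A'u dA A0; set s := dot g (invmx A *m g).
have s0 : 0 <= s by exact: invmx_quad_ge0.
have s1 : 0 < 1 + s by lra.
have -> : invmx (A + g *m g^T) *m g = (1 + s)^-1 *: (invmx A *m g).
  apply: (can_inj (mulKmx A'u)); rewrite mulmxA mulmxV// mul1mx.
  rewrite -scalemxAr mulmxDl mulmxA mulmxV// mul1mx mul_col_dot -/s.
  by rewrite -{2}(scale1r g) -scalerDl scalerA mulVf ?scale1r// gt_eqF.
rewrite det_rank1// -/s lnM// addrAC subrr add0r dotZr -/s.
have lnle : ln (1 + s)^-1 <= (1 + s)^-1 - 1.
  have -> : (1 + s)^-1 = 1 + ((1 + s)^-1 - 1) by ring.
  by rewrite (le_trans (le_ln1Dx _))// ?ltrBrDr ?addNr ?invr_gt0//; lra.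
rewrite lnV// in lnle.
have : (1 + s)^-1 * s = 1 - (1 + s)^-1.
  by rewrite -[X in 1 - X]mulr1 -{2}(mulVf (lt0r_neq0 s1)); ring.
by move=> ->; lra.
Qed.

(** Leibniz formula with [d! <= d^d]; under the logarithm this crude bound only adds [ln d] per
    dimension. *)
Lemma det_le_entries A (M : R) : (forall i j, `|A i j| <= M) ->
  `|\det A| <= (d%:R * M) ^+ d.
Proof.
move=> AM; rewrite /determinant; apply: le_trans (ler_norm_sum _ _ _) _.
apply: (@le_trans _ _ (\sum_(s : 'S_d) M ^+ d)).
  apply: ler_sum => s _; rewrite normrM normrX normrN1 expr1n mul1r normr_prod.
  rewrite -[leRHS](_ : \prod_(i < d) M = _); last by rewrite prodr_const card_ord.
  by apply: ler_prod => i _; rewrite normr_ge0 AM.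
have M0 : 0 <= M ^+ d.
  case: (d) A AM => [|n] A AM; first by rewrite expr0.
  by rewrite exprn_ge0// (le_trans (normr_ge0 _) (AM ord0 ord0)).
rewrite sumr_const card_Sn exprMn -(mulr_natl (M ^+ d)); apply: ler_wpM2r => //.
rewrite -natrX ler_nat.
rewrite -ffactnn ffact_prod -[leqRHS]muln1.
apply: (@leq_trans (\prod_(i < d) d)); last by rewrite prod_nat_const card_ord muln1.
by apply: leq_prod => i _; rewrite leq_subr.
Qed.

End RankOne.

Section Cumul.
Context {V : Type} {R : realType}.

(** Histories are stored most recent first, so each summand sees its own element and its strict
    past: the common shape of regrets and of martingales. *)
Fixpoint cumul (F : seq V -> V -> R) (h : seq V) : R :=
  if h is v :: h' then F h' v + cumul F h' else 0.

End Cumul.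

(** * Rounding an expert's prediction to the grid *)

Section Rounding.
Context {R : realType} {N : nat}.
Hypothesis N0 : (0 < N)%N.

Lemma proj01_itv (r : R) : 0 <= proj01 r <= 1.
Proof.
rewrite /proj01 le_max lexx/= ge_max ler01/= ge_min lexx //.
Qed.

Lemma proj01_closer (r : R) (y : bool) :
  (proj01 r - y%:R) ^+ 2 <= (r - y%:R) ^+ 2.
Proof.
have y01 : 0 <= (y%:R : R) <= 1 by case: y; rewrite /= ler01 lexx.
have {y01} [y0 y1] : 0 <= (y%:R : R) /\ (y%:R : R) <= 1 by apply/andP.
rewrite /proj01; have [r1|r1] := leP 1 r.
  rewrite max_r ?ler01// -subr_ge0.
  have -> : (r - y%:R) ^+ 2 - (1 - y%:R) ^+ 2 = (r - 1) * (r - y%:R + (1 - y%:R)).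
    by ring.
  by apply: mulr_ge0; lra.
have [r0|r0] := leP 0 r; first by [].
rewrite -subr_ge0.
have -> : (r - y%:R) ^+ 2 - (0 - y%:R) ^+ 2 = (- r) * (2 * y%:R - r) by ring.
by apply: mulr_ge0; lra.
Qed.

(** Bias-variance decomposition: the rounded value has mean [w], and its variance
    [(w - a) * (b - w)] between neighbours [a], [b] at distance [1 / N] is at most [1 / (4 N^2)]. *)
Lemma rounding_error (w y : R) : 0 <= w <= 1 ->
  \sum_(k < N.+1) rounding N w k 0 * (grid R N k - y) ^+ 2
    <= (w - y) ^+ 2 + (4 * N%:R ^+ 2)^-1.
Proof.
move=> /andP[w0 w1]; have NR : 0 < N%:R :> R by rewrite ltr0n.
have c0 : 0 <= (4 * N%:R ^+ 2 : R)^-1 by rewrite invr_ge0 mulr_ge0// sqr_ge0.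
have [weq|wneq] := eqVneq w 1.
  rewrite (bigD1 ord_max)//= mxE weq eqxx /= eqxx mul1r.
  rewrite big1 => [|k /negbTE kN]; last first.
    by rewrite mxE eqxx -(inj_eq val_inj)/= in kN *; rewrite kN mul0r.
  by rewrite /grid divff ?gt_eqF// addr0 lerDl.
have wl1 : w < 1 by rewrite lt_neqAle wneq.
pose j := Num.truncn (w * N%:R).
have /andP[j1 j2] : j%:R <= w * N%:R < j.+1%:R 
  by rewrite truncn_itv// mulr_ge0// ltW.
have jN : (j < N)%N.
  by rewrite -(ltr_nat R) (le_lt_trans j1)// gtr_pMl.
have gE (k : nat) : (grid R N k <= w < grid R N k.+1) = (k == j).
  rewrite /grid ler_pdivrMr// ltr_pdivlMr//; apply/idP/eqP => [/andP[k1 k2]|->].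
    apply/eqP; rewrite eqn_leq -ltnS -(ltr_nat R) (le_lt_trans k1)//=.
    by rewrite -ltnS -(ltr_nat R) (le_lt_trans j1).
  by rewrite j1.
pose j0 := Ordinal (ltn_trans jN (ltnSn N)).
pose j1' := Ordinal (jN : (j.+1 < N.+1)%N).
rewrite (bigD1 j0)//= (bigD1 j1')//=; last first.
  by rewrite -(inj_eq val_inj)/= eqn_leq ltnn.
rewrite big1 ?addr0; last first.
  move=> k /andP[kj kj1]; rewrite mxE (negbTE wneq) !gE.
  rewrite -(inj_eq val_inj)/= in kj; rewrite -(inj_eq val_inj)/= in kj1.
  (* At [k = 0] the predecessor is 0 again, so the second interval in [rounding] is empty. *)
  rewrite (negbTE kj); case: (nat_of_ord k) kj kj1 => [|k'] kj kj1 /=.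
    by rewrite /grid ltNge andbN mul0r.
  by rewrite gE -eqSS (negbTE kj1) mul0r.
rewrite !mxE (negbTE wneq) !gE/= eqxx.
have -> : (j.+1 == j) = false by rewrite gtn_eqF.
set a := grid R N j; set b := grid R N j.+1.
have ab : b = a + N%:R^-1 by rewrite /a /b /grid -natr1 mulrDl mul1r.
rewrite invfM; rewrite ab.
have NI : N%:R * N%:R^-1 = 1 :> R by rewrite divff// gt_eqF.
have -> : (N%:R ^+ 2 : R)^-1 = N%:R^-1 ^+ 2 by rewrite exprVn.
set n := N%:R^-1 in NI *.
have -> : N%:R * (a + n - w) * (a - y) ^+ 2 + N%:R * (w - a) * (a + n - y) ^+ 2
   = (N%:R * n) * (w - y) ^+ 2 + (N%:R * n) * ((w - a) * (a + n - w)) by ring.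
rewrite NI !mul1r lerD2l -subr_ge0.
have -> : 4^-1 * n ^+ 2 - (w - a) * (a + n - w) = (w - a - n / 2) ^+ 2 by field.
exact: sqr_ge0.
Qed.

End Rounding.

(** * Regret of the experts and swap regret of the forecaster *)

Section Regret.
Context {R : realType} {d N : nat}.
Variables (theta1 : 'I_N.+1 -> 'cV[R]_d).
Variables (weights : seq (sample R d) -> d.-tuple R -> 'cV[R]_N.+1).
Hypothesis fcst : is_forecaster theta1 weights.
Implicit Types (h : seq (sample R d)) (i : 'I_N.+1).

Local Notation st h i := (state theta1 weights h i).
Local Notation ctx h := (forall z, List.In z h -> contexts z.1).

Lemma betaE : beta R * 640 = 1.
Proof. by rewrite /beta; apply: mulVf; rewrite pnatr_eq0. Qed.

Lemma beta_gt0 : 0 < beta R.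
Proof. by rewrite /beta invr_gt0 ltr0n. Qed.

Lemma beta_omegaE : omega R * (4 * beta R ^+ 2) = 1.
Proof.
by rewrite /omega; apply: mulVf; rewrite mulf_neq0 ?expf_neq0 ?gt_eqF ?beta_gt0.
Qed.

Lemma omega_gt0 : 0 < omega R.
Proof. by rewrite /omega invr_gt0 mulr_gt0 ?exprn_gt0 ?beta_gt0. Qed.

(** Gradient entries are at most 10, so a rank-one update moves each entry of the matrix by at most
    100, hence by at most [omega]. *)
Lemma omega_ge100 : 100 <= omega R.
Proof.
have b20 : beta R <= 20^-1 by have := betaE; lra.
have b2 : 4 * beta R ^+ 2 <= 100^-1.
  have := ler_pM (ltW beta_gt0) (ltW beta_gt0) b20 b20; rewrite expr2; lra.
have := ler_wpM2l (ltW omega_gt0) b2; rewrite beta_omegaE; lra.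
Qed.

Lemma weights_itv h x i : contexts x -> 0 <= weights h x i 0 <= 1.
Proof.
move=> cx; have [[w0 w1] _] := fcst.2 h x cx.
rewrite w0 -w1 (bigD1 i)//= lerDl sumr_ge0// => k _; exact: w0.
Qed.

Lemma residual_le5 (theta : 'cV[R]_d) (x : d.-tuple R) (y : bool) :
  ball4 theta -> contexts x -> (dot theta (vec x) - y%:R) ^+ 2 <= 25.
Proof.
move=> bt /context_dot_le cx; have := dot_ball4_le4 bt cx.
rewrite ler_norml => /andP[h1 h2].
have /andP[y0 y1] : 0 <= (y%:R : R) <= 1 by case: y; rewrite /= ler01 lexx.
have -> : 25 = 5 ^+ 2 :> R by ring.
set a := dot _ _ - _.
have := mulr_ge0 (_ : 0 <= 5 - a) (_ : 0 <= 5 + a).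
have [a1 a2] : 0 <= 5 - a /\ 0 <= 5 + a by rewrite /a; split; lra.
move=> /(_ a1 a2); nra.
Qed.

Definition grad_at h x (y : bool) i : 'cV[R]_d :=
  (2 * weights h x i 0 * (dot (st h i).1 (vec x) - y%:R)) *: vec x.

Lemma state_cons h x (y : bool) i :
  let A := (st h i).2 + grad_at h x y i *m (grad_at h x y i)^T in
  let u := (st h i).1 - (beta R)^-1 *: (invmx A *m grad_at h x y i) in
  st ((x, y) :: h) i = (argmin4 (fun theta => quad A (u - theta)), A).
Proof. by rewrite /= /ons_step gradient_loss. Qed.

(** What the regret proof asks of the matrix: symmetry and positivity for the projection, coercivity
    for invertibility, a positive determinant for the logarithm, entries growing linearly in the
    number of rounds for the final determinant bound. *)
Lemma state_invariant h i : ctx h ->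
  [/\ ball4 (st h i).1, (st h i).2^T = (st h i).2,
      forall v, omega R * dot v v <= quad (st h i).2 v,
      0 < \det (st h i).2 &
      forall j k, `|(st h i).2 j k| <= omega R * (1 + (size h)%:R)].
Proof.
elim: h => [_|[x y] h ih ch].
  split => /=; first exact: fcst.1.
  - exact: tr_scalar_mx.
  - by move=> v; rewrite quad_scalar.
  - by rewrite det_scalar exprn_gt0// omega_gt0.
  - move=> j k; rewrite addr0 mulr1 mxE normrMn.
    rewrite gtr0_norm ?omega_gt0//.
    by case: (j == k); rewrite ?mulr1n ?mulr0n// ltW// omega_gt0.
have [|bt As qA dA Ab] := ih; first by move=> z hz; apply: ch; right.
have cx : contexts x by apply: (ch (x, y)); left.
have A0 v : 0 <= quad (st h i).2 v.
  by apply: le_trans (qA v); rewrite mulr_ge0 ?dot_ge0// ltW ?omega_gt0.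
have Au := unitmx_coercive omega_gt0 qA.
rewrite state_cons; set A := _ + _; set u := _ - _; split => /=.
- by have [] := argmin4P A u.
- by rewrite linearD/= As trmx_mul trmxK.
- by move=> v; rewrite quad_rank1 (le_trans (qA v))// lerDl sqr_ge0.
- rewrite det_rank1// mulr_gt0// ltr_pwDl//.
  exact: invmx_quad_ge0.
- move=> j k; rewrite mxE (le_trans (ler_normD _ _))//.
  rewrite -natr1 [1 + (_ + 1)]addrA mulrDr mulr1 lerD//.
  have gb l : `|grad_at h x y i l 0| <= 10.
    rewrite !mxE !normrM; have /andP[p0 p1] := weights_itv h i cx.
    have : `|dot (st h i).1 (vec x) - y%:R| <= 5.
      rewrite -(ler_pXn2r (n := 2))// ?nnegrE// real_normK ?num_real//.
      by have := residual_le5 y bt cx; rewrite (_ : 5 ^+ 2 = 25 :> R)//; ring.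
    rewrite (ger0_norm p0) (ger0_norm (ler0n R 2)) => r5.
    have := coord_norm_le1 l (context_dot_le cx); rewrite mxE => x1.
    rewrite (_ : 10 = 2 * 1 * 5 * 1); last by ring.
    by rewrite !ler_pM// ?mulr_ge0.
  rewrite mxE big_ord_recl big_ord0 addr0 [_^T _ _]mxE normrM.
  apply: (@le_trans _ _ (10 * 10)); first by rewrite ler_pM.
  by have := omega_ge100; lra.
Qed.

(** Potential argument: [beta / 2] times the squared [A]-distance from the iterate to [theta] drops
    by the regret of the round, up to an increase of the log determinant. The last potential stays
    on the right with a minus sign so that the induction closes. *)
Lemma ons_regret (theta : 'cV[R]_d) h i : ball4 theta -> ctx h ->
  cumul (fun h' (z : sample R d) => weights h' z.1 i 0 *
     ((dot (st h' i).1 (vec z.1) - z.2%:R) ^+ 2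
       - (dot theta (vec z.1) - z.2%:R) ^+ 2)) h <=
  beta R / 2 * (omega R * 64 - quad (st h i).2 ((st h i).1 - theta))
  + (2 * beta R)^-1 * (ln (\det (st h i).2) - ln (\det ((omega R)%:M : 'M[R]_d))).
Proof.
have b0 := beta_gt0.
move=> bth; elim: h => [_|[x y] h ih ch].
  (* Both points lie in the ball of radius 4, so their squared distance is at most 64. *)
  rewrite [cumul _ _]/= [st _ _]/= subrr mulr0 addr0 quad_scalar.
  rewrite mulr_ge0 ?(divr_ge0 (ltW b0))// -mulrBr mulr_ge0 ?(ltW omega_gt0)//.
  have /ball4E := fcst.1 i; move/ball4E : bth.
  have := dot_ge0 (theta1 i + theta); rewrite !dot_lin (dotC theta (theta1 i)).
  lra.
have [|bt As qA dA _] := state_invariant (h := h) i.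
  by move=> z hz; apply: ch; right.
have [_ As' qA' dA' _] := state_invariant i ch.
have {}ih := ih (fun z hz => ch z (or_intror hz)).
have cx : contexts x by apply: (ch (x, y)); left.
have A0 v : 0 <= quad (st h i).2 v.
  by apply: le_trans (qA v); rewrite mulr_ge0 ?dot_ge0// ltW ?omega_gt0.
have Au := unitmx_coercive omega_gt0 qA.
have A'u := unitmx_coercive omega_gt0 qA'.
have A'0 v : 0 <= quad (st ((x, y) :: h) i).2 v.
  by apply: le_trans (qA' v); rewrite mulr_ge0 ?dot_ge0// ltW ?omega_gt0.
rewrite [cumul _ _]/=.
move: As' A'u dA' A'0 {qA'}; rewrite !state_cons /=.
set g := grad_at h x y i; set A := _ + _ => As' A'u dA' A'0.
set u := (st h i).1 - _ *: _; set t' := argmin4 _.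
have pot := elliptic_potential_step Au A'u dA A0.
rewrite -/A in pot; set D := dot g (invmx A *m g) in pot.
have proj : quad A (t' - theta) <= quad A (u - theta) by exact: projection_le.
set delta := (st h i).1 - theta; set G := dot g delta.
have quE : quad A (u - theta)
    = quad (st h i).2 delta + G ^+ 2 - 2 * (beta R)^-1 * G + (beta R)^-1 ^+ 2 * D.
  rewrite /u addrAC -/delta -scaleNr quadD// quadZ -(scalemxAr _ A) mulmxA mulmxV//.
  rewrite mul1mx dotZr quad_rank1 -/G (dotC delta g) -/G.
  rewrite (quadE A) mulmxA mulmxV// mul1mx (dotC _ g) -/D; ring.
have /andP[p0 p1] := weights_itv h i cx.
have := residual_le5 y bt cx.
set p := weights h x i 0 in p0 p1 *.
set a := dot (st h i).1 (vec x) - y%:R; set b := dot theta (vec x) - y%:R => a25.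
have GE : G = 2 * p * a * (a - b).
  rewrite /G /g /grad_at -/p -/a dotZl /delta dotDr dotNr !(dotC (vec x)) /a /b.
  ring.
(* Exp-concavity: the factor [2 * beta * p * a^2] is at most 50 / 640. *)
have curv : beta R / 2 * G ^+ 2 <= p * (a - b) ^+ 2.
  have -> : beta R / 2 * G ^+ 2 = (beta R * 2 * (p * a ^+ 2)) * (p * (a - b) ^+ 2).
    by rewrite GE; field.
  have P0 : 0 <= p * (a - b) ^+ 2 by apply: mulr_ge0 => //; exact: sqr_ge0.
  apply: ler_piMl => //.
  have : p * a ^+ 2 <= 1 * 25 by rewrite ler_pM ?sqr_ge0.
  move=> pa25; have := ler_wpM2l (mulr_ge0 (ltW b0) (ler0n R 2)) pa25.
  by have := betaE; lra.
(* The loss is quadratic, so its second-order expansion at the iterate is exact. *)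
have lin : p * (a ^+ 2 - b ^+ 2) = G - p * (a - b) ^+ 2 by rewrite GE; ring.
rewrite quE in proj.
have proj' : beta R / 2 * quad A (t' - theta) <=
  beta R / 2 * quad (st h i).2 delta + beta R / 2 * G ^+ 2 - G + (2 * beta R)^-1 * D.
  have -> : beta R / 2 * quad (st h i).2 delta + beta R / 2 * G ^+ 2 - G
      + (2 * beta R)^-1 * D = beta R / 2 * (quad (st h i).2 delta + G ^+ 2
         - 2 * (beta R)^-1 * G + (beta R)^-1 ^+ 2 * D).
    by field; rewrite gt_eqF.
  by rewrite ler_wpM2l// divr_ge0// ltW.
have pot' : (2 * beta R)^-1 * D <=
    (2 * beta R)^-1 * (ln (\det A) - ln (\det (st h i).2)).
  by rewrite ler_wpM2l// invr_ge0 mulr_ge0// ltW.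
rewrite -/delta in ih.
rewrite !mulrBr in ih pot' *; lra.
Qed.

Hypothesis d0 : (0 < d)%N.

(** Here [8 * 640] is [64 * omega * beta / 2] and 320 is [1 / (2 * beta)]. The factor [omega ^+ d]
    of the determinant bound cancels against the initial determinant. *)
Lemma ons_regret_log (theta : 'cV[R]_d) h i : ball4 theta -> ctx h ->
  cumul (fun h' (z : sample R d) => weights h' z.1 i 0 *
     ((dot (st h' i).1 (vec z.1) - z.2%:R) ^+ 2
       - (dot theta (vec z.1) - z.2%:R) ^+ 2)) h <=
  8 * 640 + 320 * (d%:R * ln (d%:R * (1 + (size h)%:R))).
Proof.
move=> bth ch; apply: le_trans (ons_regret i bth ch) _.
have [_ _ qA dA Ab] := state_invariant i ch.
have q0 : 0 <= quad (st h i).2 ((st h i).1 - theta).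
  by apply: le_trans (qA _); rewrite mulr_ge0 ?dot_ge0// ltW ?omega_gt0.
have M0 : 0 < omega R * (1 + (size h)%:R) by rewrite mulr_gt0 ?omega_gt0// ltr_pwDl.
have dR : 0 < d%:R :> R by rewrite ltr0n.
have lnd : ln (\det (st h i).2) - ln (\det ((omega R)%:M : 'M[R]_d))
    <= d%:R * ln (d%:R * (1 + (size h)%:R)).
  have := det_le_entries Ab; rewrite gtr0_norm// => dle.
  have : ln (\det (st h i).2) <= ln ((d%:R * (omega R * (1 + (size h)%:R))) ^+ d).
    by rewrite ler_ln ?posrE// exprn_gt0// mulr_gt0.
  rewrite det_scalar !lnXn ?mulr_gt0 ?omega_gt0//.
  have n0 : 0 < d%:R * (1 + (size h)%:R) :> R by rewrite mulr_gt0// ltr_pwDl.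
  have -> : ln (d%:R * (omega R * (1 + (size h)%:R)))
      = ln (omega R) + ln (d%:R * (1 + (size h)%:R)).
    by rewrite mulrCA; apply: lnM; rewrite posrE//; exact: omega_gt0.
  rewrite -(mulr_natl (ln (omega R)) d) -(mulr_natl (ln (omega R) + _) d) => le.
  lra.
have := ler_wpM2l (_ : 0 <= 320) lnd => /(_ (ler0n _ _)).
have bE : beta R = 640^-1 by have := betaE; lra.
have -> : (2 * beta R)^-1 = 320 by rewrite bE; field.
have : beta R / 2 * (omega R * 64 - quad (st h i).2 ((st h i).1 - theta)) <= 8 * 640.
  have : 0 <= beta R / 2 * quad (st h i).2 ((st h i).1 - theta).
    by rewrite mulr_ge0// divr_ge0// ltW// beta_gt0.
  rewrite mulrBr; have -> : beta R / 2 * (omega R * 64) = 8 * 640.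
    have := beta_omegaE; rewrite bE => o; lra.
  lra.
lra.
Qed.

Hypothesis N0 : (0 < N)%N.

(* Blum-Mansour: the fixed point [Q p = p] turns the loss of the prediction into
   the [p]-average of the losses of the rounded experts. *)
Lemma swap_loss_le h x (y : bool) : contexts x ->
  \sum_i weights h x i 0 * (grid R N i - y%:R) ^+ 2 <=
  (4 * N%:R ^+ 2)^-1 +
    \sum_i weights h x i 0 * (dot (st h i).1 (vec x) - y%:R) ^+ 2.
Proof.
move=> cx; have [[w0 w1] Qw] := fcst.2 h x cx.
set c := (4 * N%:R ^+ 2)^-1.
have -> : c = \sum_i weights h x i 0 * c by rewrite -mulr_suml w1 mul1r.
rewrite -big_split /=.
under eq_bigr do rewrite -{1}Qw mxE mulr_suml.
rewrite exchange_big/=; apply: ler_sum => i _.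
under eq_bigr do rewrite mulrAC mulrC mxE.
rewrite -mulr_sumr -mulrDr ler_wpM2l//.
apply: le_trans (rounding_error N0 _ (proj01_itv _)) _.
by rewrite addrC lerD2l proj01_closer.
Qed.

Lemma cumul_const (V : Type) (c : R) (s : seq V) :
  cumul (fun _ _ => c) s = (size s)%:R * c.
Proof. by elim: s => [|v s /= ->]; rewrite ?mul0r// -natr1 mulrDl mul1r addrC. Qed.

Lemma swap_regret (theta : 'I_N.+1 -> 'cV[R]_d) h :
  (forall i, ball4 (theta i)) -> ctx h ->
  cumul (fun h' (z : sample R d) => \sum_i weights h' z.1 i 0 *
     ((grid R N i - z.2%:R) ^+ 2 - (dot (theta i) (vec z.1) - z.2%:R) ^+ 2)) h <=
  (size h)%:R / (4 * N%:R ^+ 2)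
  + N.+1%:R * (8 * 640 + 320 * (d%:R * ln (d%:R * (1 + (size h)%:R)))).
Proof.
move=> bth ch; set B := 8 * 640 + _.
have <- : \sum_(i < N.+1) B = N.+1%:R * B.
  by rewrite sumr_const card_ord mulr_natl.
(* The closed-form bounds are traded for the experts' actual cumulative regrets: that right-hand
   side is additive over rounds, so induction on the history applies. *)
apply: le_trans (lerD (lexx _) (ler_sum _ (fun i _ => ons_regret_log i (bth i) ch))).
elim: h ch {B} => [_|[x y] h ih ch].
  by rewrite /= mul0r add0r sumr_ge0.
have cx : contexts x by apply: (ch (x, y)); left.
rewrite /= big_split/= -natr1 mulrDl mul1r.
have {}ih := ih (fun z hz => ch z (or_intror hz)).
have := swap_loss_le h y cx.
under [X in _ -> X + _ <= _]eq_bigr do rewrite mulrBr.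
under [X in _ -> _ <= _ + (X + _)]eq_bigr do rewrite mulrBr.
rewrite !sumrB; lra.
Qed.

End Regret.

(** * The Azuma-Hoeffding inequality for fresh independent samples *)

Lemma product_measure_ext (R : realType) (d1 d2 : measure_display)
    (X : measurableType d1) (Y : measurableType d2)
    (m1 m2 : {measure set (X * Y) -> \bar R}) :
  (m1 setT < +oo)%E ->
  (forall A B, measurable A -> measurable B -> m1 (A `*` B) = m2 (A `*` B)) ->
  forall Z, measurable Z -> m1 Z = m2 Z.
Proof.
move=> m1oo m12 Z mZ.
pose G : set (set (X * Y)) := [set A `*` B | A in measurable & B in measurable].
apply: (measure_unique G (fun=> setT)) => //.
- exact: measurable_prod_measurableType.
- move=> _ _ [A1 mA1 [B1 mB1 <-]] [A2 mA2 [B2 mB2 <-]].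
  exists (A1 `&` A2); first exact: measurableI.
  by exists (B1 `&` B2); [exact: measurableI|rewrite setXI].
- by move=> _; exists setT => //; exists setT => //; rewrite setXTT.
- by rewrite bigcup_const.
- by move=> _ [A mA [B mB <-]]; exact: m12.
Qed.

Lemma pushforward_measure (R : realType) (d1 d2 : measure_display)
    (X : measurableType d1) (Y : measurableType d2)
    (m : {measure set X -> \bar R}) (f : X -> Y) : measurable_fun setT f ->
  {m' : {measure set Y -> \bar R} | forall A, m' A = m (f @^-1` A)}.
Proof.
move=> mf.
by exists (measure_function_pushforward__canonical__measure_function_Measure m mf).
Qed.

(** Two passes of the rectangle argument: with the first factor confined to [A], the images on the
    last two factors agree on rectangles, hence everywhere. *)
Lemma product3_measure_ext (R : realType) (d1 d2 d3 : measure_display)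
    (Z : measurableType d1) (X : measurableType d2) (Y : measurableType d3)
    (m1 m2 : {measure set (Z * (X * Y)) -> \bar R}) :
  (m1 setT < +oo)%E ->
  (forall A B C, measurable A -> measurable B -> measurable C ->
    m1 (A `*` (B `*` C)) = m2 (A `*` (B `*` C))) ->
  forall W, measurable W -> m1 W = m2 W.
Proof.
move=> m1oo m12; apply: product_measure_ext => // A W mA mW.
have mAT : measurable (A `*` [set: X * Y]) by exact: measurableX.
have [n1 n1E] := pushforward_measure (mrestr m1 mAT) measurable_snd.
have [n2 n2E] := pushforward_measure (mrestr m2 mAT) measurable_snd.
have e (m : {measure set (Z * (X * Y)) -> \bar R}) V :
    m (A `*` V) = mrestr m mAT (snd @^-1` V).
  rewrite /mrestr; congr (m _).
  by apply/seteqP; split => -[z v] /= => [[? ?]|[? []]].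
rewrite !e -n1E -n2E; apply: product_measure_ext => // [|B C mB mC].
  have <- : m1 (A `*` setT) = n1 setT by rewrite n1E; exact: e.
  by rewrite (le_lt_trans _ m1oo)// le_measure ?inE.
by rewrite n1E n2E -[LHS]e -[RHS]e m12.
Qed.

Lemma measurable_integral_section (R : realType) (d1 d2 : measure_display)
    (Z : measurableType d1) (W : measurableType d2) (nu : probability W R)
    (f : Z * W -> \bar R) :
  measurable_fun setT f -> (forall p, 0 <= f p)%E ->
  measurable_fun setT (fun h => \int[nu]_v f (h, v))%E.
Proof. by move=> mf f0; exact: measurable_fun_fubini_tonelli_F. Qed.

(** The joint law of [H] and [V] is the law of [H] times [nu], and Tonelli integrates [V] out first.
    This stands in for conditioning on [H]. *)
Lemma integral_independent (R : realType) (dO d1 d2 : measure_display)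
    (Omega : measurableType dO) (P : probability Omega R)
    (Z : measurableType d1) (W : measurableType d2) (nu : probability W R)
    (H : {mfun Omega >-> Z}) (V : {mfun Omega >-> W}) (f : Z * W -> \bar R) :
  (forall A B, measurable A -> measurable B ->
    P (H @^-1` A `&` V @^-1` B) = P (H @^-1` A) * nu B)%E ->
  measurable_fun setT f -> (forall p, 0 <= f p)%E ->
  (\int[P]_w f (H w, V w) = \int[P]_w \int[nu]_v f (H w, v))%E.
Proof.
move=> HV mf f0.
have mHV : measurable_fun setT (fun w => (H w, V w)) by exact: measurable_fun_pair.
pose st : {mfun Omega >-> (Z * W)%type} :=
  HB.pack (fun w => (H w, V w)) (isMeasurableFun.Build _ _ _ _ _ mHV).
pose m2 : {measure set (Z * W) -> \bar R} := (distribution P H \x nu)%E.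
have lawE A : measurable A -> distribution P st A = m2 A.
  apply: product_measure_ext => [|B C mB mC].
    by rewrite (le_lt_trans (probability_le1 _ _))// ltry.
  by rewrite /m2/= product_measure1E// -HV.
transitivity (\int[distribution P st]_p f p)%E.
  by rewrite ge0_integral_distribution.
rewrite (eq_measure_integral m2) => [|A mA _]; last exact: lawE.
rewrite /m2/= fubini_tonelli1// ge0_integral_distribution//.
  exact: measurable_fun_fubini_tonelli_F.
by move=> h; apply: integral_ge0 => v _.
Qed.

Lemma independent_pair (R : realType) (dO d1 d2 : measure_display)
    (Omega : measurableType dO) (P : probability Omega R)
    (X : measurableType d1) (Y : measurableType d2)
    (D : probability X R) (rho : probability Y R)
    (V : Omega -> X * Y) (G : set Omega) :
  measurable_fun setT V -> measurable G ->
  (forall B C, measurable B -> measurable C ->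
    P (G `&` V @^-1` (B `*` C)) = P G * (D B * rho C))%E ->
  forall B, measurable B -> (P (G `&` V @^-1` B) = P G * (D \x rho) B)%E.
Proof.
move=> mV mG h B mB.
have [m1 m1E] := pushforward_measure (mrestr P mG) mV.
pose q : {nonneg R} := NngNum (fine_ge0 (measure_ge0 P G)).
pose m2 : {measure set (X * Y) -> \bar R} := mscale q (D \x rho)%E.
have qE : q%:num%:E = P G by rewrite /= fineK// fin_num_measure.
suff : m1 B = m2 B by rewrite m1E /m2 /= /mscale qE /mrestr setIC.
apply: product_measure_ext => // [|A C mA mC].
  have -> : m1 setT = P (setT `&` G) by rewrite m1E.
  by rewrite setTI (le_lt_trans (probability_le1 _ _))// ltry.
have pE : (D \x rho)%E (A `*` C) = (D A * rho C)%E by exact: product_measure1E.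
by rewrite m1E /m2 /= /mscale qE [X in (_ * X)%E]pE -h// /mrestr setIC.
Qed.

(** * Independence of past and present, exponential moments *)

Section History.
Context {R : realType} {dO : measure_display} {Omega : measurableType dO}.
Variable P : probability Omega R.
Context {d1 d2 : measure_display} {U : measurableType d1} {E : measurableType d2}.
Variables (D : probability U R) (rho : probability E R).
Variables (T : nat) (S : nat -> Omega -> U) (r : nat -> Omega -> E).
Hypothesis mS : forall n, measurable_fun setT (S n).
Hypothesis mr : forall n, measurable_fun setT (r n).

(** A cylinder constraining rounds [n] to [T - 1] only, that is, the future of a history of length
    [n]. *)
Definition box (n : nat) (B : nat -> set U) (C : nat -> set E) : set Omega :=
  [set w | forall k, (n <= k < T)%N -> B k (S k w) /\ C k (r k w)].

Definition box_mass (n : nat) (B : nat -> set U) (C : nat -> set E) : R :=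
  \prod_(n <= k < T) (fine (D (B k)) * fine (rho (C k))).

Hypothesis indep : forall B C, (forall k, measurable (B k)) ->
  (forall k, measurable (C k)) -> P (box 0 B C) = (box_mass 0 B C)%:E.

Fixpoint hist (n : nat) (w : Omega) : n.-tuple (U * E) :=
  if n is k.+1 then [the k.+1.-tuple _ of (S k w, r k w) :: hist k w]
  else [tuple].

Definition step (n : nat) (w : Omega) : n.-tuple (U * E) * (U * E) :=
  (hist n w, (S n w, r n w)).

Lemma measurable_hist n : measurable_fun setT (hist n).
Proof.
elim: n => [|n ih]; first by apply/measurable_fun_tnthP => -[].
by apply: measurable_cons => //; exact: measurable_fun_pair.
Qed.

Lemma measurable_step n : measurable_fun setT (step n).
Proof.
apply: measurable_fun_pair; first exact: measurable_hist.
exact: measurable_fun_pair.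
Qed.

Lemma measurable_box n B C : (forall k, measurable (B k)) ->
  (forall k, measurable (C k)) -> measurable (box n B C).
Proof.
move=> mB mC.
rewrite (_ : box n B C = \bigcap_(k in [set k | (n <= k < T)%N])
    (S k @^-1` B k `&` r k @^-1` C k)).
  apply: bigcap_measurableType => k _.
  by apply: measurableI; rewrite -[_ @^-1` _]setTI; [exact: mS|exact: mr].
by apply/seteqP; split.
Qed.

Lemma box_recl n B C : (n < T)%N ->
  box n B C = (S n @^-1` B n `&` r n @^-1` C n) `&` box n.+1 B C.
Proof.
move=> nT; apply/seteqP; split => w /=.
  move=> h; split; first by apply: h; rewrite leqnn.
  by move=> k /andP[nk kT]; apply: h; rewrite kT ltnW.
move=> [hn h] k /andP[]; rewrite leq_eqVlt => /predU1P[<- //|nk kT].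
by apply: h; rewrite nk.
Qed.

Lemma box_mass_recl n B C : (n < T)%N ->
  box_mass n B C = fine (D (B n)) * fine (rho (C n)) * box_mass n.+1 B C.
Proof. by move=> nT; rewrite /box_mass big_ltn. Qed.

Lemma box_ge n B B' C C' : (forall k, (n <= k)%N -> B k = B' k /\ C k = C' k) ->
  box n B C = box n B' C'.
Proof.
move=> h; apply/seteqP; split => w /= hw k /[dup] nk /andP[/h[e1 e2] _].
  by rewrite -e1 -e2; exact: hw.
by rewrite e1 e2; exact: hw.
Qed.

Lemma box_mass_ge n B B' C C' :
  (forall k, (n <= k)%N -> B k = B' k /\ C k = C' k) ->
  box_mass n B C = box_mass n B' C'.
Proof.
move=> h; rewrite /box_mass !big_nat; apply: eq_bigr => k /andP[/h[-> ->] _].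
by [].
Qed.

Lemma box_setT n : box n (fun=> setT) (fun=> setT) = setT.
Proof. by apply/seteqP; split. Qed.

Lemma box_mass_setT n : box_mass n (fun=> setT) (fun=> setT) = 1.
Proof. by rewrite /box_mass !probability_setT mulr1 big1_eq. Qed.

Lemma box_mass_ge0 n B C : 0 <= box_mass n B C.
Proof. by apply: prodr_ge0 => k _; rewrite mulr_ge0 ?fine_ge0. Qed.

(** Induction on the cut between past and future: round [n] moves from the box into the history, and
    the claim for the longer history reduces to products of an event of the old history, one of the
    new sample and one of the new randomness. *)
Lemma hist_box_indep n A B C : (n <= T)%N -> measurable A ->
  (forall k, measurable (B k)) -> (forall k, measurable (C k)) ->
  P (hist n @^-1` A `&` box n B C) = (P (hist n @^-1` A) * (box_mass n B C)%:E)%E.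
Proof.
elim: n A B C => [|n ih] A B C nT mA mB mC.
  have [A0|A0] := pselect (A [tuple]).
    rewrite (_ : hist 0 @^-1` A = setT); last by apply/seteqP; split.
    by rewrite setTI probability_setT mul1e indep.
  rewrite (_ : hist 0 @^-1` A = set0); last by apply/seteqP; split.
  by rewrite set0I measure0 mul0e.
have mbox := measurable_box n.+1 mB mC.
have [m1 m1E] := pushforward_measure (mrestr P mbox) (@measurable_step n).
have [m0 m0E] := pushforward_measure P (@measurable_step n).
pose q : {nonneg R} := NngNum (box_mass_ge0 n.+1 B C).
pose m2 : {measure set (n.-tuple (U * E) * (U * E)) -> \bar R} := mscale q m0.
pose cns (p : n.-tuple (U * E) * (U * E)) : n.+1.-tuple (U * E) :=
  [the n.+1.-tuple (U * E)%type of p.2 :: p.1].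
pose A' := cns @^-1` A.
have mA' : measurable A'.
  rewrite /A' -[_ @^-1` _]setTI.
  by apply: (measurable_cons (f := snd) (g := fst)).
suff : m1 A' = m2 A' by rewrite m1E /m2/= /mscale m0E muleC.
apply: product3_measure_ext => // [|A0 B0 C0 mA0 mB0 mC0].
  have -> : m1 setT = P (setT `&` box n.+1 B C) by rewrite m1E.
  by rewrite setTI (le_lt_trans (probability_le1 _ _))// ltry.
(* [B1], [C1] impose the rectangle in round [n] and the box afterwards; [B2], [C2] impose the
   rectangle alone. The induction hypothesis for each evaluates one of the two measures. *)
pose B1 k := if k == n then B0 else B k.
pose C1 k := if k == n then C0 else C k.
pose B2 k := if k == n then B0 else setT.
pose C2 k := if k == n then C0 else setT.
have mB1 k : measurable (B1 k) by rewrite /B1; case: ifP.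
have mC1 k : measurable (C1 k) by rewrite /C1; case: ifP.
have mB2 k : measurable (B2 k) by rewrite /B2; case: ifP.
have mC2 k : measurable (C2 k) by rewrite /C2; case: ifP.
have h1 k : (n.+1 <= k)%N -> B1 k = B k /\ C1 k = C k.
  by move=> nk; rewrite /B1 /C1 gtn_eqF.
have h2 k : (n.+1 <= k)%N -> B2 k = setT /\ C2 k = setT.
  by move=> nk; rewrite /B2 /C2 gtn_eqF.
have := ih A0 B1 C1 (ltnW nT) mA0 mB1 mC1.
have := ih A0 B2 C2 (ltnW nT) mA0 mB2 mC2.
rewrite !(box_recl _ _ nT) !(box_mass_recl _ _ nT) (box_ge h1) (box_ge h2).
rewrite box_setT setIT.
rewrite (box_mass_ge h1) (box_mass_ge h2) box_mass_setT mulr1.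
rewrite /B1 /B2 /C1 /C2 !eqxx => e2 e1.
rewrite m1E /m2 /= /mscale m0E /mrestr/=.
rewrite (_ : step n @^-1` _ = hist n @^-1` A0 `&` (S n @^-1` B0 `&` r n @^-1` C0)).
  by rewrite -setIA e1 e2 EFinM muleA muleC.
by apply/seteqP; split.
Qed.

(** Tower property: with the history fixed, the pair of round [n] is integrated against its own
    law. *)
Lemma integral_step n (f : n.-tuple (U * E) * (U * E) -> \bar R) : (n < T)%N ->
  measurable_fun [set: (n.-tuple (U * E) * (U * E))%type] f ->
  (forall p, 0 <= f p)%E ->
  (\int[P]_w f (step n w) = \int[P]_w \int[D \x rho]_v f (hist n w, v))%E.
Proof.
move=> nT mf f0.
pose hs : {RV P >-> n.-tuple (U * E)} :=
  HB.pack (hist n) (isMeasurableFun.Build _ _ _ _ _ (@measurable_hist n)).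
have mV : measurable_fun setT (fun w => (S n w, r n w)).
  exact: measurable_fun_pair.
pose V : {mfun Omega >-> (U * E)%type} :=
  HB.pack (fun w => (S n w, r n w)) (isMeasurableFun.Build _ _ _ _ _ mV).
apply: (integral_independent (H := hs) (V := V)) => // A W mA mW.
have mhA : measurable (hist n @^-1` A).
  by rewrite -[_ @^-1` _]setTI; exact: measurable_hist.
apply: independent_pair => // B C mB mC.
pose B2 k := if k == n then B else setT.
pose C2 k := if k == n then C else setT.
have mB2 k : measurable (B2 k) by rewrite /B2; case: ifP.
have mC2 k : measurable (C2 k) by rewrite /C2; case: ifP.
have h2 k : (n.+1 <= k)%N -> B2 k = setT /\ C2 k = setT.
  by move=> nk; rewrite /B2 /C2 gtn_eqF.
have := hist_box_indep (ltnW nT) mA mB2 mC2.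
rewrite (box_recl _ _ nT) (box_mass_recl _ _ nT) (box_ge h2) (box_mass_ge h2) box_setT.
rewrite box_mass_setT mulr1 setIT /B2 /C2 eqxx EFinM !fineK ?fin_num_measure//.
Qed.

Variables (z : seq (U * E) -> U * E -> R) (c : R).
Hypothesis mz : forall n,
  measurable_fun [set: (n.-tuple (U * E) * (U * E))%type] (fun p => z p.1 p.2).
Hypothesis zc : forall h v, `|z h v| <= c.
Hypothesis z0 : forall n (h : n.-tuple (U * E)),
  (\int[D \x rho]_v (z h v)%:E = 0)%E.

Lemma measurable_cumul n :
  measurable_fun [set: n.-tuple (U * E)] (fun h => cumul z h).
Proof.
elim: n => [|n ih].
  rewrite (_ : (fun _ => _) = cst 0); first exact: measurable_cst.
  by apply/funext => h; rewrite (tuple0 h).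
pose bh (h : n.+1.-tuple (U * E)) : n.-tuple (U * E) := [tuple of behead h].
have mbh : measurable_fun setT bh.
  apply/measurable_fun_tnthP => i.
  rewrite (_ : _ \o _ = fun h => tnth h (lift ord0 i)); first exact: measurable_tnth.
  apply/funext => h /=; rewrite !(tnth_nth (thead h)) /= nth_behead.
  by rewrite /bump leq0n add1n.
have mhd : measurable_fun setT (fun h : n.+1.-tuple (U * E) => thead h).
  exact: measurable_tnth.
rewrite (_ : (fun _ => _) = fun h => z (bh h) (thead h) + cumul z (bh h)).
  apply: measurable_funD; last exact: (measurableT_comp ih mbh).
  have mp : measurable_fun setT (fun h : n.+1.-tuple (U * E) => (bh h, thead h)).
    exact: measurable_fun_pair.
  exact: (measurableT_comp (mz (n := n)) mp).
by apply/funext => h; rewrite {1}(tuple_eta h).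
Qed.

(** The exponential is at most [1 / (1 - x)], and [(1 + x + 2 x^2) (1 - x) - 1 = x^2 (1 - 2 x)]. *)
Lemma expR_quadratic (x : R) : x <= 1 / 2 -> expR x <= 1 + x + 2 * x ^+ 2.
Proof.
move=> x12; have x1 : 0 < 1 - x by lra.
have : 1 - x <= expR (- x) by exact: expR_ge1Dx.
rewrite expRN -[in X in X -> _](invrK (1 - x)) lef_pV2 ?posrE ?invr_gt0 ?expR_gt0//.
move=> /le_trans; apply; rewrite -(mul1r (1 - x)^-1) ler_pdivrMr//.
have : 0 <= x ^+ 2 * (1 - 2 * x) by apply: mulr_ge0; [exact: sqr_ge0|lra].
by move=> h; rewrite -subr_ge0; apply: le_trans h _; rewrite -subr_ge0; lra.
Qed.

Lemma integrable_z n (h : n.-tuple (U * E)) :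
  (D \x rho)%E.-integrable setT (EFin \o z h).
Proof.
apply: measurable_bounded_integrable => //.
- by rewrite (le_lt_trans (probability_le1 _ _))// ltry.
- have mp : measurable_fun setT (fun v : U * E => (h, v)).
    by apply: measurable_fun_pair => //; exact: measurable_cst.
  exact: (measurableT_comp (mz (n := n)) mp).
- exists c; split; first exact: num_real.
  by move=> M cM v _ /=; apply: le_trans (zc _ _) _; exact: ltW.
Qed.

Lemma mgf_increment_le n (h : n.-tuple (U * E)) (l : R) : 0 <= l -> l * c <= 1 / 2 ->
  (\int[D \x rho]_v (expR (l * z h v))%:E <= (1 + 2 * (l * c) ^+ 2)%:E)%E.
Proof.
move=> l0 lc; have iz := integrable_z h.
have lz v : `|l * z h v| <= l * c by rewrite normrM ger0_norm// ler_wpM2l.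
have mzh : measurable_fun setT (z h) by have /integrableP[/measurable_EFinP] := iz.
have i2 : (D \x rho)%E.-integrable setT (fun v => (l * z h v)%:E).
  by under eq_fun do rewrite EFinM; exact: integrableZl.
have i1 : (D \x rho)%E.-integrable setT (cst (1 + 2 * (l * c) ^+ 2)%:E).
  apply: (measurable_bounded_integrable (f := cst (1 + 2 * (l * c) ^+ 2))) => //.
    by rewrite (le_lt_trans (probability_le1 _ _))// ltry.
  exact: bounded_cst.
apply: (@le_trans _ _ (\int[D \x rho]_v
    ((cst (1 + 2 * (l * c) ^+ 2)%:E v) + (l * z h v)%:E))%E).
  have mlz : measurable_fun setT (fun v => l * z h v).
    by apply: measurable_funM; [exact: measurable_cst|exact: mzh].
  apply: ge0_le_integral => //.
  - by apply/measurable_EFinP; exact: measurableT_comp.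
  - by apply: emeasurable_funD; [exact: measurable_cst|exact/measurable_EFinP].
  - move=> v _; rewrite /cst/= -EFinD lee_fin.
    have := lz v; rewrite ler_norml => /andP[l1 l2].
    apply: le_trans (expR_quadratic (le_trans l2 lc)) _.
    have := @ler_pM _ _ _ _ _ (normr_ge0 _) (normr_ge0 _) (lz v) (lz v).
    rewrite -normrM ger0_norm -?expr2 ?sqr_ge0// => sq; lra.
rewrite integralD//=.
rewrite integral_cst// [X in (_ * X + _)%E](_ : _ = 1%E) ?mule1; last first.
  exact: probability_setT.
rewrite [X in (_ + X)%E](_ : _ = 0%E) ?adde0//.
by under eq_integral do rewrite EFinM; rewrite integralZl// z0 mule0.
Qed.

(** Rounds are peeled off from the newest: given the history, its factor has mean at most
    [1 + 2 (l c)^2] because the increment is centred. *)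
Lemma mgf_cumul_le n (l : R) : (n <= T)%N -> 0 <= l -> l * c <= 1 / 2 ->
  (\int[P]_w (expR (l * cumul z (hist n w)))%:E <=
     ((1 + 2 * (l * c) ^+ 2) ^+ n)%:E)%E.
Proof.
move=> + l0 lc; elim: n => [_|n ih nT].
  rewrite /= mulr0 expR0 (_ : (fun _ => _) = cst 1%E)// integral_cst//.
  by rewrite [X in (1 * X)%E](_ : _ = 1%E) ?mule1 ?expr0//; exact: probability_setT.
pose f (p : n.-tuple (U * E) * (U * E)) : \bar R :=
  ((expR (l * cumul z p.1))%:E * (expR (l * z p.1 p.2))%:E)%E.
have mcum : measurable_fun [set: n.-tuple (U * E)]
    (fun h => (expR (l * cumul z h))%:E).
  apply/measurable_EFinP; apply: measurableT_comp => //.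
  by apply: measurable_funM => //; exact: measurable_cumul.
have mf : measurable_fun setT f.
  apply: emeasurable_funM; first exact: (measurableT_comp mcum measurable_fst).
  apply/measurable_EFinP; apply: measurableT_comp => //.
  by apply: measurable_funM; [exact: measurable_cst|exact: mz].
have f0 p : (0 <= f p)%E by rewrite mule_ge0// lee_fin expR_ge0.
have -> : (\int[P]_w (expR (l * cumul z (hist n.+1 w)))%:E
    = \int[P]_w f (step n w))%E.
  apply: eq_integral => w _; rewrite /f /= -EFinM -expRD; congr (expR _)%:E.
  by rewrite mulrDr addrC.
rewrite integral_step//.
have K0 : 0 <= 1 + 2 * (l * c) ^+ 2 by rewrite addr_ge0// mulr_ge0// sqr_ge0.
have mh := @measurable_hist n.
apply: (@le_trans _ _ (\int[P]_w
    ((1 + 2 * (l * c) ^+ 2)%:E * (expR (l * cumul z (hist n w)))%:E))%E).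
  apply: ge0_le_integral => //.
  - by move=> w _; apply: integral_ge0 => v _.
  - have mF := measurable_integral_section (D \x rho)%E mf f0.
    exact: (measurableT_comp mF mh).
  - by apply: emeasurable_funM => //; exact: (measurableT_comp mcum mh).
  - move=> w _; rewrite /f/= ge0_integralZl//=.
    + by rewrite muleC lee_wpmul2r ?lee_fin ?expR_ge0// mgf_increment_le.
    + have /integrableP[/measurable_EFinP mzh _] := integrable_z (hist n w).
      by apply/measurable_EFinP; apply: measurableT_comp => //; exact: measurable_funM.
rewrite ge0_integralZl//.
  by rewrite [_ ^+ n.+1]exprS EFinM lee_wpmul2l ?lee_fin// ih// ltnW.
exact: (measurableT_comp mcum mh).
Qed.

Lemma azuma (e : R) : (0 < T)%N -> 0 < c -> 0 < e ->
  (P [set w | (e < cumul z (hist T w))%R] <= (expR (- (e ^+ 2 / (8 * T%:R * c ^+ 2))))%:E)%E.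
Proof.
move=> T0 c0 e0; have TR : 0 < T%:R :> R by rewrite ltr0n.
have cumle n : forall h : n.-tuple (U * E), cumul z h <= n%:R * c.
  move=> h; rewrite -{2}(size_tuple h); elim: {h}(tval h) => [|v h ih] /=.
    by rewrite mul0r.
  by rewrite -natr1 mulrDl mul1r addrC lerD// (le_trans (ler_norm _)).
have mX : measurable_fun setT (fun w => cumul z (hist T w)).
  exact: (measurableT_comp (@measurable_cumul T) (@measurable_hist T)).
(* The sum never exceeds [T c], so only [e <= 2 T c] is at stake; there the [l] chosen below
   satisfies [l c <= 1 / 2]. *)
have [eTc|eTc] := leP e (2 * T%:R * c); last first.
  rewrite (_ : [set w | _] = set0) ?measure0 ?lee_fin ?expR_ge0//.
  apply/seteqP; split => w //=; rewrite ltNge => /negP; apply.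
  apply: le_trans (cumle _ _) _; rewrite (le_trans _ (ltW eTc))//.
  by rewrite -mulrA; have := mulr_gt0 TR c0; lra.
(* Minimizer of the exponent [2 T (l c)^2 - l e], whose minimum is [- e^2 / (8 T c^2)]. *)
pose l := e / (4 * T%:R * c ^+ 2).
have den0 : 0 < 4 * T%:R * c ^+ 2 by rewrite !mulr_gt0.
have l0 : 0 < l by rewrite divr_gt0.
have lc : l * c <= 1 / 2.
  rewrite /l mulrAC ler_pdivrMr//; have := ler_wpM2r (ltW c0) eTc.
  by rewrite expr2; lra.
have mlt : measurable [set w | e < cumul z (hist T w)].
  rewrite (_ : [set w | _] = (fun w => cumul z (hist T w)) @^-1` `]e, +oo[%classic).
    by rewrite -[_ @^-1` _]setTI; exact: mX.
  by apply/seteqP; split => w /=; rewrite in_itv/= andbT.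
have mle : measurable [set w | e <= cumul z (hist T w)].
  rewrite (_ : [set w | _] = (fun w => cumul z (hist T w)) @^-1` `[e, +oo[%classic).
    by rewrite -[_ @^-1` _]setTI; exact: mX.
  by apply/seteqP; split => w /=; rewrite in_itv/= andbT.
pose X : {RV P >-> R} :=
  HB.pack (fun w => cumul z (hist T w)) (isMeasurableFun.Build _ _ _ _ _ mX).
have sub : [set w | e < cumul z (hist T w)] `<=` [set w | X w >= e].
  by move=> w /= /ltW.
apply: (@le_trans _ _ (P [set w | X w >= e])).
  by apply: le_measure => //; rewrite inE.
apply: le_trans (chernoff X e l0) _.
have := mgf_cumul_le (leqnn T) (ltW l0) lc => m.
have mE : ('M_P X l = \int[P]_w (expR (l * cumul z (hist T w)))%:E)%E.
  rewrite /mmt_gen_fun expectation.unlock; apply: eq_integral => w _ /=.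
  by rewrite mulrC.
rewrite mE; apply: le_trans (lee_wpmul2r _ m) _; first by rewrite lee_fin expR_ge0.
rewrite -EFinM lee_fin.
have pw : (1 + 2 * (l * c) ^+ 2) ^+ T <= expR (T%:R * (2 * (l * c) ^+ 2)).
  rewrite expRM_natl ler_pXn2r ?nnegrE ?expR_ge0 ?expR_ge1Dx//.
  by rewrite addr_ge0// mulr_ge0// sqr_ge0.
apply: le_trans (ler_wpM2r (expR_ge0 _) pw) _.
rewrite -expRD ler_expR.
rewrite le_eqVlt; apply/orP; left; apply/eqP; rewrite /l; field.
by rewrite !gt_eqF.
Qed.

End History.

(** * Conditional risks of the forecaster *)

Section Sampler.
Context {R : realType} {d1 d2 : measure_display}.
Context {X : measurableType d1} {E : measurableType d2} {N : nat}.
Variables (D : probability (X * bool)%type R) (rho : probability E R).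
Variable pred : seq (X * bool) -> E -> X -> 'I_N.+1.
Hypothesis mpred : forall n i, measurable
  [set z : n.-tuple (X * bool) * E * X | pred z.1.1 z.1.2 z.2 = i].
Variables (ell : 'I_N.+1 -> X * bool -> R) (K : R).
Hypothesis mell : forall i, measurable_fun setT (ell i).
Hypothesis ellK : forall i u, 0 <= ell i u <= K.

(** Read off from the sampler rather than from the weights of the forecaster: measurability is
    available for [pred], and both agree on contexts. *)
Definition wt (h : seq (X * bool)) (x : X) (i : 'I_N.+1) : R :=
  fine (rho [set e | pred h e x = i]).

Definition risk (h : seq (X * bool)) (e : E) : R :=
  fine (\int[D]_u (ell (pred h e u.1) u)%:E)%E.

Definition avg (h : seq (X * bool)) (u : X * bool) : R :=
  \sum_i wt h u.1 i * ell i u.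

(** The martingale difference. [unzip1] drops past randomness, since predictors depend on past
    samples only. *)
Definition dev (h : seq (X * bool * E)) (v : X * bool * E) : R :=
  risk (unzip1 h) v.2 - avg (unzip1 h) v.1.

Lemma measurable_unzip1 n : measurable_fun setT
  (fun h : n.-tuple (X * bool * E) => [tuple of unzip1 h]).
Proof.
apply/measurable_fun_tnthP => i.
rewrite (_ : _ \o _ = fun h => (tnth h i).1); last first.
  by apply/funext => h /=; rewrite tnth_map.
exact: (measurableT_comp measurable_fst (measurable_tnth i)).
Qed.

Lemma measurable_pred_section n (h : n.-tuple (X * bool)) (e : E) i :
  measurable [set x | pred h e x = i].
Proof.
have mf : measurable_fun setT (fun x : X => (h, e, x)).
  by apply: measurable_fun_pair => //; exact: measurable_cst.
by have := mf measurableT _ (@mpred n i); rewrite setTI.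
Qed.

Lemma measurable_pred_rand n (h : n.-tuple (X * bool)) (x : X) i :
  measurable [set e | pred h e x = i].
Proof.
have mf : measurable_fun setT (fun e : E => (h, e, x)).
  apply: measurable_fun_pair; last exact: measurable_cst.
  by apply: measurable_fun_pair => //; exact: measurable_cst.
by have := mf measurableT _ (@mpred n i); rewrite setTI.
Qed.

Lemma measurable_wt n i : measurable_fun setT
  (fun p : n.-tuple (X * bool) * X => wt p.1 p.2 i).
Proof.
pose Q := [set q : (n.-tuple (X * bool) * X) * E | pred q.1.1 q.2 q.1.2 = i].
have mQ : measurable Q.
  pose f (q : (n.-tuple (X * bool) * X) * E) := (q.1.1, q.2, q.1.2).
  have mf : measurable_fun setT f.
    apply: measurable_fun_pair.
      apply: measurable_fun_pair => //.
      exact: (measurableT_comp measurable_fst measurable_fst).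
    exact: (measurableT_comp measurable_snd measurable_fst).
  by have := mf measurableT _ (@mpred n i); rewrite setTI.
have mx := measurable_fun_xsection rho mQ.
apply/measurable_EFinP.
apply: (eq_measurable_fun (fun p => rho (xsection Q p))) => // p _ /=.
rewrite /wt fineK; last first.
  by apply: fin_num_measure; exact: measurable_pred_rand.
by congr (rho _); apply/seteqP; split => e /=; rewrite /xsection/= inE.
Qed.

Lemma wt_ge0 h x i : 0 <= wt h x i.
Proof. exact: fine_ge0. Qed.

Lemma sum_wt h x : \sum_i wt h x i = 1.
Proof.
have mE i : measurable [set e | pred h e x = i].
  exact: (measurable_pred_rand (in_tuple h)).
apply: EFin_inj; rewrite -sumEFin.
under eq_bigr do rewrite fineK ?fin_num_measure//.
transitivity (\int[rho]_e \sum_i (\1_[set e | pred h e x = i] e)%:E)%E.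
  rewrite ge0_integral_sum//.
    by apply: eq_bigr => i _; rewrite integral_indic// setIT.
  by move=> i; apply/measurable_EFinP; exact: measurable_indic.
transitivity (\int[rho]_e (cst 1%E) e)%E.
  apply: eq_integral => e _; rewrite (bigD1 (pred h e x))//= indicE mem_set//.
  rewrite big1 ?adde0// => i ip; rewrite indicE memNset//.
  by move=> /= /esym/eqP; rewrite (negbTE ip).
by rewrite integral_cst// mul1e; exact: probability_setT.
Qed.

Lemma avg_itv h u : 0 <= avg h u <= K.
Proof.
apply/andP; split.
  by apply: sumr_ge0 => i _; rewrite mulr_ge0 ?wt_ge0//; have /andP[] := ellK i u.
rewrite -[K]mul1r -(sum_wt h u.1) mulr_suml; apply: ler_sum => i _.
by rewrite ler_wpM2l ?wt_ge0//; have /andP[] := ellK i u.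
Qed.

(** [pred] takes finitely many values, so the loss is a finite sum of measurable functions cut off
    to the events [M i]. *)
Lemma measurable_loss n : measurable_fun setT
  (fun p : (n.-tuple (X * bool) * E) * (X * bool) =>
     (ell (pred p.1.1 p.1.2 p.2.1) p.2)%:E).
Proof.
apply/measurable_EFinP.
pose M i := [set p : (n.-tuple (X * bool) * E) * (X * bool) |
  pred p.1.1 p.1.2 p.2.1 = i].
have mM i : measurable (M i).
  pose f (p : (n.-tuple (X * bool) * E) * (X * bool)) := (p.1, p.2.1).
  have mf : measurable_fun setT f.
    apply: measurable_fun_pair => //.
    exact: (measurableT_comp measurable_fst measurable_snd).
  by have := mf measurableT _ (@mpred n i); rewrite setTI.
rewrite (_ : (fun _ => _) = fun p => \sum_i \1_(M i) p * ell i p.2); last first.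
  apply/funext => p; rewrite (bigD1 (pred p.1.1 p.1.2 p.2.1))//= indicE.
  rewrite mem_set// mul1r big1 ?addr0// => i ip; rewrite indicE memNset ?mul0r//.
  by move=> /= /esym/eqP; rewrite (negbTE ip).
apply: measurable_sum => i; apply: measurable_funM.
  exact: measurable_indic.
exact: (measurableT_comp (mell i) measurable_snd).
Qed.

Lemma measurable_loss_section n (h : n.-tuple (X * bool)) (e : E) :
  measurable_fun setT (fun u => (ell (pred h e u.1) u)%:E).
Proof.
have mp : measurable_fun setT (fun u : X * bool => (h, e, u)).
  by apply: measurable_fun_pair => //; exact: measurable_cst.
exact: (measurableT_comp (@measurable_loss n) mp).
Qed.

Lemma integral_loss_itv h e :
  (0 <= \int[D]_u (ell (pred h e u.1) u)%:E <= K%:E)%E.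
Proof.
have m := measurable_loss_section (in_tuple h) e.
apply/andP; split.
  by apply: integral_ge0 => u _; rewrite lee_fin; have /andP[] := ellK (pred h e u.1) u.
apply: (@le_trans _ _ (\int[D]_u (cst K%:E) u)%E).
  apply: ge0_le_integral => //.
  - by move=> u _; rewrite lee_fin; have /andP[] := ellK (pred h e u.1) u.
  - by move=> u _; rewrite lee_fin; have /andP[] := ellK (pred h e u.1) u.
by rewrite integral_cst// [X in (_ * X)%E](_ : _ = 1%E) ?mule1//; exact: probability_setT.
Qed.

Lemma riskE h e : (\int[D]_u (ell (pred h e u.1) u)%:E)%E = (risk h e)%:E.
Proof.
have /andP[a b] := integral_loss_itv h e.
by rewrite fineK// ge0_fin_numE// (le_lt_trans b)// ltry.
Qed.

Lemma risk_itv h e : 0 <= risk h e <= K.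
Proof. by have := integral_loss_itv h e; rewrite riskE !lee_fin. Qed.

Lemma dev_bound h v : `|dev h v| <= K.
Proof.
have /andP[a1 a2] := risk_itv (unzip1 h) v.2.
have /andP[b1 b2] := avg_itv (unzip1 h) v.1.
by rewrite /dev ler_norml; apply/andP; split; lra.
Qed.

Lemma measurable_risk n : measurable_fun setT
  (fun p : n.-tuple (X * bool) * E => risk p.1 p.2).
Proof.
apply/measurable_EFinP.
have l0 (p : n.-tuple (X * bool) * E * (X * bool)) :
    (0 <= (ell (pred p.1.1 p.1.2 p.2.1) p.2)%:E :> \bar R)%E.
  by rewrite lee_fin; have /andP[] := ellK (pred p.1.1 p.1.2 p.2.1) p.2.
have := measurable_integral_section D (@measurable_loss n) l0.
by apply: eq_measurable_fun => p _ /=; rewrite riskE.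
Qed.

Lemma measurable_avg n : measurable_fun setT
  (fun p : n.-tuple (X * bool) * (X * bool) => avg p.1 p.2).
Proof.
apply: measurable_sum => i; apply: measurable_funM; last first.
  exact: (measurableT_comp (mell i) measurable_snd).
have mp : measurable_fun setT
    (fun p : n.-tuple (X * bool) * (X * bool) => (p.1, p.2.1)).
  apply: measurable_fun_pair => //.
  exact: (measurableT_comp measurable_fst measurable_snd).
exact: (measurableT_comp (@measurable_wt n i) mp).
Qed.

Lemma measurable_dev n : measurable_fun
  [set: (n.-tuple (X * bool * E) * (X * bool * E))%type] (fun p => dev p.1 p.2).
Proof.
have mh : measurable_fun setT
    (fun p : n.-tuple (X * bool * E) * (X * bool * E) => [tuple of unzip1 p.1]).
  exact: (measurableT_comp (@measurable_unzip1 n) measurable_fst).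
apply: measurable_funB.
  have mp : measurable_fun setT
      (fun p : n.-tuple (X * bool * E) * (X * bool * E) =>
        ([tuple of unzip1 p.1], p.2.2)).
    apply: measurable_fun_pair => //.
    exact: (measurableT_comp measurable_snd measurable_snd).
  exact: (measurableT_comp (@measurable_risk n) mp).
have mp : measurable_fun setT
    (fun p : n.-tuple (X * bool * E) * (X * bool * E) =>
      ([tuple of unzip1 p.1], p.2.1)).
  apply: measurable_fun_pair => //.
  exact: (measurableT_comp measurable_fst measurable_snd).
exact: (measurableT_comp (@measurable_avg n) mp).
Qed.

Lemma integral_rand_loss n (h : n.-tuple (X * bool)) (u : X * bool) :
  (\int[rho]_e (ell (pred h e u.1) u)%:E)%E = (avg h u)%:E.
Proof.
have mE i : measurable [set e | pred h e u.1 = i] by exact: measurable_pred_rand.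
have -> : (\int[rho]_e (ell (pred h e u.1) u)%:E
   = \int[rho]_e \sum_i ((ell i u)%:E * (\1_[set e | pred h e u.1 = i] e)%:E))%E.
  apply: eq_integral => e _; rewrite (bigD1 (pred h e u.1))//= indicE mem_set//.
  rewrite mule1 big1 ?adde0// => i ip; rewrite indicE memNset ?mule0//.
  by move=> /= /esym/eqP; rewrite (negbTE ip).
have l0 i : (0 <= (ell i u)%:E :> \bar R)%E.
  by rewrite lee_fin; have /andP[] := ellK i u.
rewrite ge0_integral_sum//; last first.
- by move=> i e _; rewrite mule_ge0// lee_fin.
- by move=> i; apply: emeasurable_funM => //; apply/measurable_EFinP; exact: measurable_indic.
rewrite /avg -sumEFin; apply: eq_bigr => i _.
rewrite ge0_integralZl//; last first.
  by apply/measurable_EFinP; exact: measurable_indic.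
by rewrite integral_indic// setIT EFinM fineK ?fin_num_measure// muleC.
Qed.

(** Both terms have as mean the double integral of [ell (pred h e u.1) u] over [u] and [e], taken in
    the two orders; Tonelli equates them. *)
Lemma dev_centered n (h : n.-tuple (X * bool * E)) :
  (\int[D \x rho]_v (dev h v)%:E = 0)%E.
Proof.
set h1 : n.-tuple (X * bool) := [tuple of unzip1 h].
have ma : measurable_fun setT (fun v : X * bool * E => risk h1 v.2).
  have mp : measurable_fun setT (fun v : X * bool * E => (h1, v.2)).
    by apply: measurable_fun_pair => //; exact: measurable_cst.
  exact: (measurableT_comp (@measurable_risk n) mp).
have mb1 : measurable_fun setT (fun u : X * bool => avg h1 u).
  have mp : measurable_fun setT (fun v : X * bool => (h1, v)).
    by apply: measurable_fun_pair => //; exact: measurable_cst.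
  exact: (measurableT_comp (@measurable_avg n) mp).
have mb : measurable_fun setT (fun v : X * bool * E => avg h1 v.1).
  exact: (measurableT_comp mb1 measurable_fst).
have ia : (D \x rho)%E.-integrable setT (fun v => (risk h1 v.2)%:E).
  apply: (measurable_bounded_integrable (f := fun v => risk h1 v.2)) => //.
    by rewrite (le_lt_trans (probability_le1 _ _))// ltry.
  exists K; split; first exact: num_real.
  move=> M KM v _ /=; have /andP[a1 a2] := risk_itv h1 v.2.
  by rewrite ger0_norm// (le_trans a2)// ltW.
have ib : (D \x rho)%E.-integrable setT (fun v => (avg h1 v.1)%:E).
  apply: (measurable_bounded_integrable (f := fun v => avg h1 v.1)) => //.
    by rewrite (le_lt_trans (probability_le1 _ _))// ltry.
  exists K; split; first exact: num_real.
  move=> M KM v _ /=; have /andP[a1 a2] := avg_itv h1 v.1.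
  by rewrite ger0_norm// (le_trans a2)// ltW.
have -> : (\int[D \x rho]_v (dev h v)%:E
  = \int[D \x rho]_v ((risk h1 v.2)%:E - (avg h1 v.1)%:E))%E by [].
rewrite integralB//.
have risk0 e : (0 <= (risk h1 e)%:E :> \bar R)%E.
  by rewrite lee_fin; have /andP[] := risk_itv h1 e.
have avg0 u : (0 <= (avg h1 u)%:E :> \bar R)%E.
  by rewrite lee_fin; have /andP[] := avg_itv h1 u.
have -> : (\int[D \x rho]_v (avg h1 v.1)%:E = \int[D]_u (avg h1 u)%:E)%E.
  rewrite (fubini_tonelli1 (fun v => (avg h1 v.1)%:E))//; last exact/measurable_EFinP.
  apply: eq_integral => u _; rewrite /fubini_F/=.
  rewrite (_ : (fun _ => _) = cst (avg h1 u)%:E)// integral_cst//.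
  by rewrite [X in (_ * X)%E](_ : _ = 1%E) ?mule1//; exact: probability_setT.
have -> : (\int[D \x rho]_v (risk h1 v.2)%:E = \int[rho]_e (risk h1 e)%:E)%E.
  rewrite (fubini_tonelli2 (fun v => (risk h1 v.2)%:E))//; last exact/measurable_EFinP.
  apply: eq_integral => e _; rewrite /fubini_G/=.
  rewrite (_ : (fun _ => _) = cst (risk h1 e)%:E)// integral_cst//.
  by rewrite [X in (_ * X)%E](_ : _ = 1%E) ?mule1//; exact: probability_setT.
have mL : measurable_fun setT
    (fun p : E * (X * bool) => (ell (pred h1 p.1 p.2.1) p.2)%:E).
  have mp : measurable_fun setT (fun p : E * (X * bool) => ((h1, p.1), p.2)).
    apply: measurable_fun_pair => //.
    by apply: measurable_fun_pair => //; exact: measurable_cst.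
  exact: (measurableT_comp (@measurable_loss n) mp).
have -> : (\int[rho]_e (risk h1 e)%:E = \int[D]_u (avg h1 u)%:E)%E.
  under eq_integral do rewrite -riskE.
  under [RHS]eq_integral do rewrite -integral_rand_loss.
  apply: (fubini_tonelli (fun p : E * (X * bool) =>
    (ell (pred h1 p.1 p.2.1) p.2)%:E)) => // p.
  by rewrite lee_fin; have /andP[] := ellK (pred h1 p.1 p.2.1) p.2.
apply: subee; rewrite ge0_fin_numE; last exact: integral_ge0.
apply: (@le_lt_trans _ _ (\int[D]_u (cst K%:E) u)%E).
  apply: ge0_le_integral => //; first exact/measurable_EFinP.
  by move=> u _; rewrite lee_fin; have /andP[] := avg_itv h1 u.
rewrite integral_cst// [X in (_ * X)%E](_ : _ = 1%E) ?mule1 ?ltry//.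
exact: probability_setT.
Qed.

End Sampler.

(** * Comparators and their discretization *)

Section Comparators.
Context {R : realType} {d : nat}.

(* A context [x] with [x_0 = 1/2] and the other coordinates proportional to
   those of [theta] nearly maximizes [|<theta, x>|]. *)
Lemma Flin4_ball4 (theta : 'cV[R]_d) : (0 < d)%N ->
  (forall x : d.-tuple R, contexts x -> dot theta (vec x) ^+ 2 <= 4) ->
  ball4 theta.
Proof.
case: d theta => // m theta _ h.
pose t := theta ord0 0; pose s := \sum_(i < m) theta (lift ord0 i) 0 ^+ 2.
have s0 : 0 <= s by apply: sumr_ge0 => i _; exact: sqr_ge0.
have tt : dot theta theta = t ^+ 2 + s.
  by rewrite dotE big_ord_recl -expr2; congr (_ + _); apply: eq_bigr => i _; rewrite expr2.
(* With 1/4 of the squared norm spent on the first coordinate, 3/4 is left for the others. The sign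
   makes the cross term [t * k * s] nonnegative, and for [s = 0] the inverse, hence [k], is 0. *)
pose k := if 0 <= t then Num.sqrt (3 / (4 * s)) else - Num.sqrt (3 / (4 * s)).
have q0 : 0 <= 3 / (4 * s) by rewrite divr_ge0// mulr_ge0.
have k2 : k ^+ 2 = 3 / (4 * s).
  by rewrite /k; case: ifP => _; rewrite ?sqrrN sqr_sqrtr.
have tk : 0 <= t * k.
  rewrite /k; case: ifPn => [t0|]; first by rewrite mulr_ge0// sqrtr_ge0.
  by rewrite -ltNge => /ltW t0; rewrite mulrN -mulNr mulr_ge0// ?oppr_ge0// sqrtr_ge0.
pose x : m.+1.-tuple R :=
  [tuple (if i == ord0 then 2^-1 else k * theta i 0) | i < m.+1].
have xE : dot (vec x) (vec x) = 4^-1 + k ^+ 2 * s.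
  rewrite dotE big_ord_recl; congr (_ + _).
    by rewrite !mxE !tnth_mktuple/=; field.
  rewrite mulr_sumr; apply: eq_bigr => i _.
  by rewrite !mxE !tnth_mktuple/=; ring.
have txE : dot theta (vec x) = t / 2 + k * s.
  rewrite dotE big_ord_recl; congr (_ + _); first by rewrite !mxE tnth_mktuple.
  rewrite mulr_sumr; apply: eq_bigr => i _.
  by rewrite !mxE !tnth_mktuple/=; ring.
have k2s : k ^+ 2 * s <= 3 / 4.
  rewrite k2; have [->|sn] := eqVneq s 0; first by rewrite mulr0 divr_ge0.
  by rewrite le_eqVlt; apply/orP; left; apply/eqP; field.
have cx : contexts x.
  split; first by rewrite enorm_le// xE expr1n; lra.
  move=> j j0; rewrite tnth_mktuple (_ : j = ord0)//; exact: val_inj.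
apply/ball4E; rewrite tt; have := h x cx; rewrite txE => h1.
have k2ss : k ^+ 2 * s ^+ 2 = 3 / 4 * s.
  rewrite k2; have [->|sn] := eqVneq s 0; first by rewrite expr0n /= !mulr0.
  by field.
have : (t / 2 + k * s) ^+ 2 = t ^+ 2 / 4 + t * k * s + 3 / 4 * s.
  by rewrite -k2ss; field.
move=> e; rewrite e in h1; have := mulr_ge0 tk s0; have := sqr_ge0 t; lra.
Qed.

Definition lossdiff (N : nat) (theta : 'I_N.+1 -> 'cV[R]_d) (i : 'I_N.+1)
    (u : sample R d) : R :=
  (grid R N i - u.2%:R) ^+ 2 - (dot (theta i) (vec u.1) - u.2%:R) ^+ 2.

(* The shift by 36 makes the loss nonnegative, so that Tonelli applies, and the
   indicator makes it bounded outside the contexts. *)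
Definition ell (N : nat) (theta : 'I_N.+1 -> 'cV[R]_d) (i : 'I_N.+1)
    (u : sample R d) : R :=
  36 + \1_[set u | contexts u.1] u * lossdiff theta i u.

(** Net points may leave the ball of radius 4, so only their predictions on contexts are bounded: 4
    for the ball plus one unit for the discretization. *)
Definition admissible (v : 'cV[R]_d) : Prop :=
  forall x : d.-tuple R, contexts x -> `|dot v (vec x)| <= 5.

(** The prediction is off by at most 1 and the comparator by at most 5 + 1; the length 37 of this
    range is the increment bound in Azuma's inequality. *)
Lemma lossdiff_itv (N : nat) (theta : 'I_N.+1 -> 'cV[R]_d) i u : (0 < N)%N ->
  (forall i, admissible (theta i)) -> contexts u.1 ->
  -36 <= lossdiff theta i u <= 1.
Proof.
move=> N0 ad cu; rewrite /lossdiff; have := ad i _ cu.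
set a := dot _ _; rewrite ler_norml => /andP[a1 a2].
have NR : 0 < N%:R :> R by rewrite ltr0n.
have g0 : 0 <= grid R N i by rewrite divr_ge0.
have g1 : grid R N i <= 1 by rewrite ler_pdivrMr// mul1r ler_nat -ltnS.
set g := grid R N i in g0 g1 *.
have [y0 y1] : 0 <= (u.2%:R : R) /\ (u.2%:R : R) <= 1.
  by case: u.2; rewrite /= ?ler01 ?lexx.
set y := u.2%:R in y0 y1 *.
have h1 := mulr_ge0 (_ : 0 <= 1 - (g - y)) (_ : 0 <= 1 + (g - y)).
have {}h1 : 0 <= (1 - (g - y)) * (1 + (g - y)) by apply: h1; lra.
have h2 : 0 <= (6 - (a - y)) * (6 + (a - y)) by apply: mulr_ge0; lra.
have := sqr_ge0 (g - y); have := sqr_ge0 (a - y).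
by move=> h3 h4; apply/andP; split; nra.
Qed.

Lemma ell_context (N : nat) (theta : 'I_N.+1 -> 'cV[R]_d) i u : contexts u.1 ->
  ell theta i u = 36 + lossdiff theta i u.
Proof. by move=> cu; rewrite /ell indicE mem_set// mul1r. Qed.

Lemma ell_itv (N : nat) (theta : 'I_N.+1 -> 'cV[R]_d) i u : (0 < N)%N ->
  (forall i, admissible (theta i)) -> 0 <= ell theta i u <= 37.
Proof.
move=> N0 ad; have [cu|ncu] := pselect (contexts u.1).
  rewrite ell_context//; have /andP[h1 h2] := lossdiff_itv i N0 ad cu.
  by apply/andP; split; lra.
by rewrite /ell indicE memNset// mul0r; apply/andP; split; lra.
Qed.

Lemma measurable_dot (theta : 'cV[R]_d) :
  measurable_fun setT (fun x : d.-tuple R => dot theta (vec x)).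
Proof.
rewrite (_ : (fun _ => _) = fun x => \sum_j theta j 0 * tnth x j).
  apply: measurable_sum => j; apply: measurable_funM; first exact: measurable_cst.
  exact: measurable_tnth.
by apply/funext => x; rewrite dotE; apply: eq_bigr => j _; rewrite mxE.
Qed.

Lemma measurable_contexts : measurable (@contexts R d).
Proof.
rewrite (_ : @contexts R d = (fun x : d.-tuple R => \sum_j tnth x j ^+ 2) @^-1` `]-oo, 1]
    `&` \bigcap_(j in [set j : 'I_d | j = 0%N :> nat])
          ((fun x => tnth x j) @^-1` [set 2^-1])); last first.
  have e (x : d.-tuple R) : \sum_j tnth x j ^+ 2 = dot (vec x) (vec x).
    by rewrite dotE; apply: eq_bigr => j _; rewrite mxE expr2.
  apply/seteqP; split => x /=; rewrite /contexts /= enorm_le// expr1n in_itv/= e.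
    by move=> [h1 h2]; split.
  by move=> [h1 h2]; split.
apply: measurableI.
  rewrite -[_ @^-1` _]setTI.
  have mf : measurable_fun setT (fun x : d.-tuple R => \sum_j tnth x j ^+ 2).
    apply: measurable_sum => j; apply: measurable_funX; exact: measurable_tnth.
  exact: mf.
apply: fin_bigcap_measurable => // j _.
rewrite -[_ @^-1` _]setTI; exact: measurable_tnth.
Qed.

Lemma measurable_lossdiff (N : nat) (theta : 'I_N.+1 -> 'cV[R]_d) i :
  measurable_fun setT (lossdiff theta i).
Proof.
have my : measurable_fun setT (fun u : sample R d => u.2%:R : R).
  have mb : measurable_fun setT (fun b : bool => b%:R : R) by [].
  exact: (measurableT_comp mb measurable_snd).
apply: measurable_funB; apply: measurable_funX; apply: measurable_funB => //.
exact: (measurableT_comp (measurable_dot (theta i)) measurable_fst).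
Qed.

Lemma measurable_ell (N : nat) (theta : 'I_N.+1 -> 'cV[R]_d) i :
  measurable_fun setT (ell theta i).
Proof.
apply: measurable_funD; first exact: measurable_cst.
apply: measurable_funM; last exact: measurable_lossdiff.
apply: measurable_indic; rewrite (_ : [set u | _] = fst @^-1` @contexts R d)//.
rewrite -[_ @^-1` _]setTI; apply: measurable_fst => //.
exact: measurable_contexts.
Qed.

(** A grid of mesh [8 / M] in the cube of side 8. Inadmissible points are replaced by 0, so every
    index gives an admissible family and the union bound ranges over the whole finite type. *)
Definition net (N M : nat) (k : {ffun 'I_N.+1 * 'I_d -> 'I_M.+1}) (i : 'I_N.+1) :
    'cV[R]_d :=
  let v : 'cV[R]_d := \col_j (-4 + 8 * (k (i, j))%:R / M%:R) in
  if `[< admissible v >] then v else 0.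

Lemma net_admissible N M k i : admissible (@net N M k i).
Proof.
rewrite /net; case: asboolP => // _ x _.
by rewrite -(scale0r 0) dotZl mul0r normr0.
Qed.

Lemma ball4_admissible (v : 'cV[R]_d) : ball4 v -> admissible v.
Proof.
move=> bv x /context_dot_le cx; apply: le_trans (dot_ball4_le4 bv cx) _; lra.
Qed.

(** Context coordinates are at most 1 in absolute value, so an error [8 / M] per coordinate shifts
    predictions by at most [8 * d / M]; [8 * d <= M] makes this at most 1 and the rounded point
    admissible. *)
Lemma net_dense (N M : nat) (theta : 'I_N.+1 -> 'cV[R]_d) : (0 < M)%N ->
  (8 * d <= M)%N -> (forall i, ball4 (theta i)) ->
  exists k : {ffun 'I_N.+1 * 'I_d -> 'I_M.+1}, forall i x, contexts x ->
    `|dot (theta i) (vec x) - dot (net k i) (vec x)| <= 8 * d%:R / M%:R.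
Proof.
move=> M0 dM bt; have MR : 0 < M%:R :> R by rewrite ltr0n.
pose q (i : 'I_N.+1) (j : 'I_d) : R := (theta i j 0 + 4) * M%:R / 8.
have th4 i j : -4 <= theta i j 0 <= 4.
  have /ball4E := bt i; rewrite dotE (bigD1 j)//= -expr2 => h.
  have s0 : 0 <= \sum_(l < d | l != j) theta i l 0 * theta i l 0.
    by rewrite sumr_ge0// => l _; rewrite -expr2 sqr_ge0.
  rewrite -ler_norml -(ler_pXn2r (n := 2))// ?nnegrE// real_normK ?num_real//.
  rewrite (_ : (4 : R) ^+ 2 = 16); last by ring.
  lra.
have q0 i j : 0 <= q i j.
  have /andP[h1 h2] := th4 i j.
  by rewrite divr_ge0// mulr_ge0//; lra.
have qM i j : q i j <= M%:R.
  have /andP[h1 h2] := th4 i j; rewrite ler_pdivrMr// mulrC ler_wpM2l//; lra.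
have tM i j : (Num.truncn (q i j) < M.+1)%N.
  have /andP[h1 _] := truncn_itv (q0 i j).
  by rewrite ltnS -(ler_nat R) (le_trans h1).
pose k : {ffun 'I_N.+1 * 'I_d -> 'I_M.+1} := [ffun p => Ordinal (tM p.1 p.2)].
exists k => i.
pose v : 'cV[R]_d := \col_j (-4 + 8 * (k (i, j))%:R / M%:R).
have vE j : `|theta i j 0 - v j 0| <= 8 / M%:R.
  rewrite mxE ffunE /=; have /andP[h1 h2] := truncn_itv (q0 i j).
  have -> : theta i j 0 = -4 + 8 * q i j / M%:R by rewrite /q; field; rewrite gt_eqF.
  set tr := (Num.truncn _)%:R.
  have -> : -4 + 8 * q i j / M%:R - (-4 + 8 * tr / M%:R) = 8 * (q i j - tr) / M%:R.
    by ring.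
  rewrite ger0_norm; last first.
    by rewrite divr_ge0// mulr_ge0// subr_ge0.
  rewrite ler_wpM2r ?invr_ge0 ?ltW//.
  rewrite -natr1 in h2; lra.
have close x : contexts x -> `|dot (theta i) (vec x) - dot v (vec x)| <= 8 * d%:R / M%:R.
  move=> /context_dot_le cx; rewrite -dotNl -dotDl dotE.
  apply: le_trans (ler_norm_sum _ _ _) _.
  apply: (@le_trans _ _ (\sum_(j < d) 8 / M%:R)).
    apply: ler_sum => j _; rewrite normrM -[leRHS]mulr1.
    by apply: ler_pM => //; [rewrite !mxE; have := vE j; rewrite mxE|exact: coord_norm_le1].
  by rewrite sumr_const card_ord -[leLHS]mulr_natr; rewrite mulrAC.
have av : admissible v.
  move=> x cx; have := close x cx; have := dot_ball4_le4 (bt i) (context_dot_le cx).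
  have : 8 * d%:R / M%:R <= 1 :> R by rewrite ler_pdivrMr// mul1r -natrM ler_nat.
  rewrite !ler_norml => h /andP[h1 h2] /andP[h3 h4]; apply/andP; split; lra.
by move=> x cx; rewrite /net -/v asboolT//; exact: close.
Qed.

Lemma ell_close (N : nat) (theta g : 'I_N.+1 -> 'cV[R]_d) (eta : R) i u : 0 <= eta ->
  (forall i, admissible (theta i)) -> (forall i, admissible (g i)) ->
  (forall i x, contexts x -> `|dot (theta i) (vec x) - dot (g i) (vec x)| <= eta) ->
  ell theta i u <= ell g i u + 12 * eta.
Proof.
move=> eta0 at_ ag cl; have [cu|ncu] := pselect (contexts u.1); last first.
  by rewrite /ell !indicE !memNset// !mul0r; lra.
rewrite !ell_context// /lossdiff.
have := at_ i _ cu; have := ag i _ cu; have := cl i _ cu.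
set a := dot (theta i) _; set b := dot (g i) _.
have [y0 y1] : 0 <= (u.2%:R : R) /\ (u.2%:R : R) <= 1.
  by case: u.2; rewrite /= ?ler01 ?lexx.
set y := u.2%:R in y0 y1 *.
move=> h1 /[!ler_norml] /andP[h2 h3] /andP[h4 h5].
(* The cofactor [a + b - 2 y] in the difference of squares is at most 5 + 5 + 2. *)
have : (b - y) ^+ 2 - (a - y) ^+ 2 <= eta * 12.
  have -> : (b - y) ^+ 2 - (a - y) ^+ 2 = (a - b) * - (a + b - 2 * y) by ring.
  apply: le_trans (ler_norm _) _; rewrite normrM ler_pM// normrN ler_norml.
  by apply/andP; split; lra.
lra.
Qed.

End Comparators.

(** * Rates *)

Section Arithmetic.
Context {R : realType}.

(* [b] stands for [(d/T)^(1/5)] and [iT] for [1/T]. *)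
Lemma error_terms_le (b iT n dd lam L lM ld : R) :
  0 < b <= 1 -> 0 < iT -> dd * iT = b ^+ 5 -> iT <= b ^+ 5 ->
  1 <= n -> (n + 1) * b <= 3 -> 1 <= 2 * n * b ->
  0 <= lM <= 8 * L -> 0 <= ld <= 2 * L -> 1 <= L -> 0 <= lam ->
  iT * (Num.sqrt (8 * iT^-1 * 37 ^+ 2 * ((n + 1) * dd * lM + lam)) + 24
    + iT^-1 / (4 * n ^+ 2) + (n + 1) * (8 * 640 + 320 * (dd * ld)))
  <= 2 * 100 * 100 * L * (b ^+ 2 + b ^+ 2 * Num.sqrt lam).
Proof.
move=> /andP[b0 b1] iT0 ddE iTb n1 nb3 nb1 /andP[lM0 lML] /andP[ld0 ldL] L1 lam0.
have bb (i j : nat) : (i <= j)%N -> b ^+ j <= b ^+ i.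
  move=> ij; rewrite -(subnKC ij) exprD ler_piMr ?exprn_ge0 ?(ltW b0)//.
  by rewrite exprn_ile1// ltW.
have r0 : 0 <= b ^+ 2 by rewrite exprn_ge0// ltW.
have n0 : 0 < n by lra.
have s0 := sqrtr_ge0 lam; have sE : Num.sqrt lam ^+ 2 = lam by rewrite sqr_sqrtr.
set sl := Num.sqrt lam in s0 sE *.
have nb5 : (n + 1) * b ^+ 5 <= 3 * b ^+ 4.
  by rewrite exprS mulrA ler_wpM2r// exprn_ge0// ltW.
(* [111 = 3 * 37]: with [1 / T] moved under the root the factor is [8 * 37 ^+ 2], and 8 is rounded
   up to the square 9. *)
have t1 : iT * Num.sqrt (8 * iT^-1 * 37 ^+ 2 * ((n + 1) * dd * lM + lam))
    <= 111 * (b ^+ 2 * (5 * L + sl)).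
  have -> : 111 * (b ^+ 2 * (5 * L + sl))
     = iT * (iT^-1 * (111 * (b ^+ 2 * (5 * L + sl)))) by rewrite mulVKf// gt_eqF.
  rewrite ler_wpM2l ?(ltW iT0)//.
  have y0 : 0 <= iT^-1 * (111 * (b ^+ 2 * (5 * L + sl))).
    rewrite mulr_ge0 ?invr_ge0 ?(ltW iT0)// mulr_ge0// mulr_ge0//; lra.
  rewrite -(ger0_norm y0) -sqrtr_sqr ler_wsqrtr//.
  have -> : (iT^-1 * (111 * (b ^+ 2 * (5 * L + sl)))) ^+ 2
    = 37 ^+ 2 * iT^-1 ^+ 2 * (9 * (b ^+ 4 * (5 * L + sl) ^+ 2)) by ring.
  have -> : 8 * iT^-1 * 37 ^+ 2 * ((n + 1) * dd * lM + lam)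
    = 37 ^+ 2 * iT^-1 ^+ 2 * (8 * ((n + 1) * (dd * iT) * lM + iT * lam)).
    by field; rewrite gt_eqF.
  have q0 : 0 <= (37 : R) ^+ 2 * iT^-1 ^+ 2 by apply: mulr_ge0; exact: sqr_ge0.
  rewrite ler_wpM2l// ddE.
  have h1 : (n + 1) * b ^+ 5 * lM <= 3 * b ^+ 4 * (8 * L).
    by apply: ler_pM => //; rewrite mulr_ge0 ?exprn_ge0 ?(ltW b0)//; lra.
  have h2 : iT * lam <= b ^+ 4 * lam.
    by rewrite ler_wpM2r// (le_trans iTb)// bb.
  have b4 : 0 <= b ^+ 4 by rewrite exprn_ge0// ltW.
  have h3 : 24 * L + lam <= (5 * L + sl) ^+ 2.
    have := mulr_ge0 (_ : 0 <= L - 1) (_ : 0 <= L) => /(_ _ _)h.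
    have {}h : 0 <= (L - 1) * L by apply: h; lra.
    have h' : 0 <= L * sl by rewrite mulr_ge0//; lra.
    rewrite sqrrD exprMn sE; nra.
  have := ler_wpM2l b4 h3; have := mulr_ge0 b4 (sqr_ge0 (5 * L + sl)); lra.
have t2 : iT * 24 <= 24 * b ^+ 2.
  by rewrite mulrC ler_wpM2l// (le_trans iTb)// bb.
have t3 : iT * (iT^-1 / (4 * n ^+ 2)) <= b ^+ 2.
  rewrite mulVKf ?gt_eqF// -[leLHS]mul1r ler_pdivrMr; last first.
    by rewrite mulr_gt0// exprn_gt0.
  have := ler_pM ler01 ler01 nb1 nb1; rewrite mul1r => h.
  have -> : b ^+ 2 * (4 * n ^+ 2) = 2 * n * b * (2 * n * b) by ring.
  exact: h.
(* By [nb5] the experts' regret is of order [b ^+ 4] up to logarithms, below the rate; it still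
   supplies the largest constant, [3 * 9 * 640 = 17280]. *)
have t4 : iT * ((n + 1) * (8 * 640 + 320 * (dd * ld))) <= b ^+ 2 * (3 * (9 * 640) * L).
  have -> : iT * ((n + 1) * (8 * 640 + 320 * (dd * ld)))
     = 8 * 640 * ((n + 1) * iT) + 320 * ((n + 1) * (dd * iT) * ld) by ring.
  rewrite ddE.
  have h1 : (n + 1) * iT <= 3 * b ^+ 2.
    apply: (@le_trans _ _ ((n + 1) * b ^+ 5)); first by rewrite ler_wpM2l//; lra.
    by apply: le_trans nb5 _; rewrite ler_wpM2l// bb.
  have h2 : (n + 1) * b ^+ 5 * ld <= 3 * b ^+ 2 * (2 * L).
    apply: ler_pM => //; first by rewrite mulr_ge0 ?exprn_ge0 ?(ltW b0)//; lra.
    by apply: le_trans nb5 _; rewrite ler_wpM2l// bb.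
  have h3 : b ^+ 2 <= b ^+ 2 * L by rewrite ler_peMr.
  lra.
(* The four bounds add up to at most 17860 times [L * b ^+ 2] plus 111 times the term with the root,
   within 20000. *)
rewrite (mulrDr iT _ ((n + 1) * _)) (mulrDr iT _ (iT^-1 / _)) (mulrDr iT _ 24).
move: t1 t2 t3 t4; set x1 := iT * _; set x2 := iT * _; set x3 := iT * _.
set x4 := iT * _ => t1 t2 t3 t4.
have h3 : b ^+ 2 <= b ^+ 2 * L by rewrite ler_peMr.
have h5 : 0 <= b ^+ 2 * sl by rewrite mulr_ge0.
have h4 : b ^+ 2 * sl <= b ^+ 2 * sl * L by rewrite ler_peMr.
move: t1 t2 t3 t4 h3 h4 h5 r0; move: (b ^+ 2) x1 x2 x3 x4 => q x1 x2 x3 x4; clear.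
move=> *; lra.
Qed.

Lemma ln_le_id (x : R) : 0 < x -> ln x <= x.
Proof.
move=> x0; have h : ln (1 + (x - 1)) <= x - 1 by apply: le_ln1Dx; lra.
by rewrite addrC subrK in h; lra.
Qed.

(* With [u = a/(L b)], everything reduces to [2 C (11 + 5 ln u) <= u ^ 2]. *)
Lemma sample_size_le (C a b L lT lam : R) : 1 <= C -> 1 <= L -> 1 <= b ->
  ln b <= L -> 0 <= lam <= L -> 0 < a -> lT <= L + 5 * ln a ->
  32 * C * L * b <= a ->
  C * lT * (a ^- 2 + a ^- 2 * Num.sqrt lam) <= b ^- 2.
Proof.
move=> C1 L1 b1 lb /andP[lam0 lamL] a0 hlT ha.
have L0 : 0 < L by lra.
have b0 : 0 < b by lra.
have C0 : 0 < C by lra.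
pose u := a / (L * b).
have Lb0 : 0 < L * b by rewrite mulr_gt0.
have u0 : 0 < u by rewrite divr_gt0.
have aE : a = u * L * b by rewrite /u; field; rewrite !gt_eqF.
have uC : 32 * C <= u by rewrite ler_pdivlMr// mulrA.
have u1 : 1 <= u by lra.
have lna : ln a = ln u + ln L + ln b.
  have e1 : ln (u * L * b) = ln (u * L) + ln b.
    by apply: lnM; rewrite posrE// mulr_gt0.
  have e2 : ln (u * L) = ln u + ln L by apply: lnM; rewrite posrE.
  by rewrite aE e1 e2.
have lL := ln_le_id L0; have lu := ln_le_id u0.
have lu0 : 0 <= ln u by rewrite ln_ge0.
have sl : Num.sqrt lam <= L.
  have L2 : lam <= L ^+ 2 by rewrite expr2 (le_trans lamL)// ler_peMr// ltW.
  by rewrite -(ger0_norm (ltW L0)) -sqrtr_sqr ler_wsqrtr.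
have s0 := sqrtr_ge0 lam.
(* The 11 collects [L], [5 * ln L] and [5 * ln b], the last two at most [5 * L] each. *)
have h1 : lT <= L * (11 + 5 * u).
  have : ln u <= L * u by rewrite (le_trans lu)// ler_peMl// ltW.
  lra.
have ai0 : 0 < a ^- 2 by rewrite invr_gt0 exprn_gt0.
have -> : a ^- 2 + a ^- 2 * Num.sqrt lam = a ^- 2 * (1 + Num.sqrt lam) by ring.
have h2 : 1 + Num.sqrt lam <= 2 * L by lra.
(* The 32 of the hypothesis is 22 + 10, as [1 <= u]. *)
have key : 2 * C * (11 + 5 * u) <= u ^+ 2.
  have : C * 1 <= C * u by rewrite ler_wpM2l// ltW.
  have : 32 * C * u <= u * u by rewrite ler_wpM2r// ltW.
  rewrite expr2; lra.
apply: (@le_trans _ _ (C * (L * (11 + 5 * u)) * (a ^- 2 * (2 * L)))).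
  apply: (@le_trans _ _ (C * (L * (11 + 5 * u)) * (a ^- 2 * (1 + Num.sqrt lam)))).
    have p0 : 0 <= a ^- 2 * (1 + Num.sqrt lam) by apply: mulr_ge0; [exact: ltW|lra].
    by rewrite ler_wpM2r// ler_wpM2l// ltW.
  have q0 : 0 <= C * (L * (11 + 5 * u)).
    by apply: mulr_ge0; [exact: ltW|apply: mulr_ge0; lra].
  by rewrite ler_wpM2l// ler_wpM2l// ltW.
have -> : C * (L * (11 + 5 * u)) * (a ^- 2 * (2 * L))
   = (2 * C * (11 + 5 * u)) * (L ^+ 2 * a ^- 2) by ring.
have -> : b ^- 2 = u ^+ 2 * (L ^+ 2 * a ^- 2).
  by rewrite aE; field; rewrite !gt_eqF.
by rewrite ler_wpM2r// mulr_ge0// ?exprn_ge0// ltW.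
Qed.

Lemma powR_fifth (x : R) : 0 <= x -> (x `^ (1 / 5)) ^+ 5 = x.
Proof.
move=> x0; rewrite -powR_mulrn ?powR_ge0// -powRrM.
by rewrite (_ : 1 / 5 * 5%:R = 1) ?powRr1//; field.
Qed.

Lemma powR_two_fifths (x : R) : 0 < x -> x^-1 `^ (2 / 5) = (x `^ (1 / 5)) ^- 2.
Proof.
move=> x0; rewrite (_ : x^-1 = x `^ (-1)); last by rewrite powR_inv1// ltW.
rewrite -powRrM -(powR_mulrn 2 (powR_ge0 _ _)) -powRrM -powRN; congr (_ `^ _).
lra.
Qed.

Lemma powR_half_pow5 (x : R) : 0 <= x -> x `^ (- (5 / 2)) = (x `^ (- (1 / 2))) ^+ 5.
Proof.
move=> x0; rewrite -powR_mulrn ?powR_ge0// -powRrM; congr (_ `^ _); lra.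
Qed.

Lemma powR_half_sqr (x : R) : 0 < x -> (x `^ (- (1 / 2))) ^- 2 = x.
Proof.
move=> x0; rewrite -powR_mulrn ?powR_ge0// -powRrM.
rewrite (_ : - (1 / 2) * 2%:R = -1); last by field.
by rewrite powR_inv1 ?invrK// ltW.
Qed.

End Arithmetic.

(** * From online regret to swap agnostic error *)

Lemma cumul_map (V W : Type) (R : realType) (f : V -> W) (F : seq W -> W -> R) h :
  cumul (fun h v => F (map f h) (f v)) h = cumul F (map f h).
Proof. by elim: h => [//|v h /= ->]. Qed.

Lemma cumulD (V : Type) (R : realType) (F G : seq V -> V -> R) h :
  cumul (fun h v => F h v + G h v) h = cumul F h + cumul G h.
Proof. by elim: h => [|v h /= ->]; rewrite ?addr0// addrACA. Qed.

Lemma le_cumul (V : Type) (R : realType) (F G : seq V -> V -> R) h :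
  (forall h' v, List.In v h -> F h' v <= G h' v) -> cumul F h <= cumul G h.
Proof.
elim: h => [//|v h ih FG] /=; apply: lerD; first by apply: FG; left.
by apply: ih => h' w wh; apply: FG; right.
Qed.

Section OnlineToBatch.
Context {R : realType} {d N T : nat}.
Variables (D : probability (sample R d) R).
Variables (theta1 : 'I_N.+1 -> 'cV[R]_d)
    (weights : seq (sample R d) -> d.-tuple R -> 'cV[R]_N.+1)
    (dE : measure_display) (E : measurableType dE) (rho : probability E R)
    (pred : seq (sample R d) -> E -> d.-tuple R -> 'I_N.+1)
    (dO : measure_display) (Omega : measurableType dO)
    (P : probability Omega R)
    (S : 'I_T -> {RV P >-> (d.-tuple R * bool)%type})
    (r : 'I_T -> {RV P >-> E}).
Hypothesis d0 : (0 < d)%N.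
Hypothesis T0 : (0 < T)%N.
Hypothesis N0 : (0 < N)%N.
Hypothesis Dctx : D [set z | contexts z.1] = 1%E.
Hypothesis fcst : is_forecaster theta1 weights.
Hypothesis smp : is_sampler weights rho pred.
Hypothesis iid : iid_fresh D rho S r.

(** A default value extends samples to all natural indices so that histories can be built by
    recursion; only rounds below [T] are constrained. *)
Let ord k : 'I_T := insubd (Ordinal T0) k.
Let Sn (k : nat) : Omega -> sample R d := S (ord k).
Let rn (k : nat) : Omega -> E := r (ord k).

Lemma ordK (t : 'I_T) : ord t = t.
Proof. by apply: val_inj; rewrite /ord val_insubd ltn_ord. Qed.

Let mSn k : measurable_fun setT (Sn k).
Proof. exact: measurable_funPT. Qed.

Let mrn k : measurable_fun setT (rn k).
Proof. exact: measurable_funPT. Qed.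

Let mpred n i : measurable
  [set z : n.-tuple (sample R d) * E * d.-tuple R | pred z.1.1 z.1.2 z.2 = i].
Proof. exact: smp.1. Qed.

Let indep (B : nat -> set (sample R d)) (C : nat -> set E) :
  (forall k, measurable (B k)) -> (forall k, measurable (C k)) ->
  P (box T Sn rn 0 B C) = (box_mass D rho T 0 B C)%:E.
Proof.
move=> mB mC; have [lS lr ind] := iid.
pose A (s : 'I_T + 'I_T) : set Omega := match s with
  | inl t => S t @^-1` B t | inr t => r t @^-1` C t end.
have := ind [set: ('I_T + 'I_T)%type]%SET A; rewrite [X in P X](_ : _ = box T Sn rn 0 B C); last first.
  apply/seteqP; split => w /= h.
    move=> k /andP[_ kT]; have kE : k = ord k by rewrite /ord val_insubd kT.
    by split; rewrite {1}kE; [apply: (h (inl (ord k)))|apply: (h (inr (ord k)))];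
      rewrite /= inE.
  by move=> [t|t] _ /=; have [] := h t (ltn_ord t); rewrite /Sn /rn ordK.
move=> ->; last first.
  by move=> [t|t] _ /=; [exists (B t)|exists (C t)]; rewrite ?setTI.
congr (_%:E); rewrite /box_mass big_mkord big_split/=.
rewrite big_sumType/=; congr (_ * _).
  by apply: eq_big => [t|t _]; [rewrite inE|rewrite -(lS t _ (mB t))].
by apply: eq_big => [t|t _]; [rewrite inE|rewrite -(lr t _ (mC t))].
Qed.

Let H n (w : Omega) : n.-tuple (sample R d * E) := hist Sn rn n w.

Let histE n w : (n <= T)%N ->
  unzip1 (H n w) = [seq S s w | s : 'I_T <- rev (enum 'I_T) & (s < n)%N].
Proof.
move=> nT.
have -> : [seq S s w | s : 'I_T <- rev (enum 'I_T) & (s < n)%N]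
    = [seq Sn k w | k <- rev (iota 0 n)].
  rewrite -{1}(filter_iota_ltn 0 nT) -filter_rev -(val_enum_ord T) -map_rev.
  rewrite add0n filter_map -map_comp; apply/eq_in_map => t _ /=.
  by rewrite /Sn ordK.
elim: n {nT} => [//|n ih].
by rewrite -addn1 iotaD rev_cat /= -ih addn1.
Qed.

Let predictorsE (t : 'I_T) w :
  predictors pred (S^~ w) (r^~ w) t = pred (unzip1 (H t w)) (rn t w).
Proof. by rewrite /predictors histE ?(ltnW (ltn_ord t))// /rn ordK. Qed.

Let cumul_hist (F : seq (sample R d * E) -> sample R d * E -> R) n w :
  cumul F (H n w) = \sum_(t < n) F (H t w) (Sn t w, rn t w).
Proof. by elim: n => [|n ih]; rewrite ?big_ord0// big_ord_recr /= ih addrC. Qed.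

Let wtE h x i : contexts x -> wt rho pred h x i = weights h x i 0.
Proof. by move=> cx; rewrite /wt smp.2. Qed.

(** Subtracting 36 undoes the shift in [ell]: for families in the ball this is the swap error
    against [theta]. *)
Let cmp (theta : 'I_N.+1 -> 'cV[R]_d) (w : Omega) : R := T%:R^-1 *
  \sum_(t < T) risk D pred (ell theta) (unzip1 (H t w)) (rn t w) - 36.

Section Comparator.
Variables (theta : 'I_N.+1 -> 'cV[R]_d).
Hypothesis bth : forall i, ball4 (theta i).

Let adm i : admissible (theta i).
Proof. exact: ball4_admissible. Qed.

(** Contexts carry all the mass, so the cut-off alters the integrand only on a null set; the rest is
    linearity over rounds. *)
Lemma expectation_swap_loss w :
  ('E_D[(fun z => T%:R^-1 * \sum_(t < T)
     ((grid R N (predictors pred (S^~ w) (r^~ w) t z.1) - z.2%:R) ^+ 2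
      - (dot (theta (predictors pred (S^~ w) (r^~ w) t z.1)) (vec z.1) - z.2%:R) ^+ 2))%R]
  = (cmp theta w)%:E)%E.
Proof.
pose p (t : 'I_T) := pred (unzip1 (H t w)) (rn t w).
pose Y (t : 'I_T) (z : sample R d) : R := ell theta (p t z.1) z.
have ellK i u := ell_itv i u N0 adm.
have mY t : measurable_fun setT (fun z => (Y t z)%:E).
  exact: (measurable_loss_section mpred (@measurable_ell _ _ _ theta)
    [tuple of unzip1 (H t w)]).
have Y0 t z : (0 <= (Y t z)%:E)%E by rewrite lee_fin; have /andP[] := ellK (p t z.1) z.
have iY t : (\int[D]_z (Y t z)%:E)%E
    = (risk D pred (ell theta) (unzip1 (H t w)) (rn t w))%:E.
  exact: (riskE D mpred (@measurable_ell _ _ _ theta) ellK).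
have mYr t : measurable_fun setT (Y t) by have /measurable_EFinP := mY t.
have mSum : measurable_fun setT (fun z => \sum_(t < T) Y t z) by exact: measurable_sum.
have iSum : (\int[D]_z (\sum_(t < T) Y t z)%:E = (\sum_(t < T)
    risk D pred (ell theta) (unzip1 (H t w)) (rn t w))%:E)%E.
  under eq_integral do rewrite -sumEFin.
  by rewrite ge0_integral_sum// -sumEFin; apply: eq_bigr => t _; rewrite iY.
pose X z : R := T%:R^-1 * \sum_(t < T) lossdiff theta (p t z.1) z.
pose X' z : R := T%:R^-1 * (\sum_(t < T) Y t z) - 36.
have TR : 0 < T%:R :> R by rewrite ltr0n.
have XX' z : contexts z.1 -> X z = X' z.
  move=> cz; rewrite /X' /Y; under eq_bigr do rewrite ell_context//.
  rewrite big_split/= sumr_const card_ord mulrDr -[36 *+ T]mulr_natl mulKf ?gt_eqF//.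
  by rewrite addrAC subrr add0r.
have mX' : measurable_fun setT X'.
  by apply: measurable_funB => //; apply: measurable_funM.
have mX : measurable_fun setT X.
  apply: measurable_funM => //; apply: measurable_sum => t.
  pose M i := [set z : sample R d | p t z.1 = i].
  have mM i : measurable (M i).
    rewrite (_ : M i = fst @^-1` [set x | p t x = i])//.
    rewrite -[_ @^-1` _]setTI; apply: measurable_fst => //.
    exact: (measurable_pred_section mpred [tuple of unzip1 (H t w)]).
  rewrite (_ : (fun _ => _) = fun z => \sum_i \1_(M i) z * lossdiff theta i z).
    apply: measurable_sum => i; apply: measurable_funM; last exact: measurable_lossdiff.
    exact: measurable_indic.
  apply/funext => z; rewrite (bigD1 (p t z.1))//= indicE mem_set// mul1r.
  rewrite big1 ?addr0// => i ip; rewrite indicE memNset ?mul0r//.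
  by move=> /= /esym/eqP; rewrite (negbTE ip).
have -> : (fun z : sample R d => T%:R^-1 * \sum_(t < T)
     ((grid R N (predictors pred (S^~ w) (r^~ w) t z.1) - z.2%:R) ^+ 2
      - (dot (theta (predictors pred (S^~ w) (r^~ w) t z.1)) (vec z.1) - z.2%:R) ^+ 2))
   = X.
  apply/funext => z; rewrite /X; congr (_ * _); apply: eq_bigr => t _.
  by rewrite predictorsE.
rewrite expectation.unlock.
rewrite (ae_eq_integral (EFin \o X'))//; last first.
- have mctx : measurable [set z : sample R d | contexts z.1].
    rewrite (_ : [set z | _] = fst @^-1` @contexts R d)//.
    rewrite -[_ @^-1` _]setTI; apply: measurable_fst => //.
    exact: measurable_contexts.
  exists (~` [set z | contexts z.1]); split.
  + exact: measurableC.
  + transitivity (1 - D [set z | contexts z.1])%E; first exact: probability_setC.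
    by rewrite Dctx subee.
  + by move=> z /= nz cz; apply: nz => _; rewrite XX'.
- exact/measurable_EFinP.
- exact/measurable_EFinP.
have i1 : D.-integrable setT (EFin \o (fun z => T%:R^-1 * \sum_(t < T) Y t z)).
  apply/integrableP; split; first by apply/measurable_EFinP; exact: measurable_funM.
  rewrite (eq_integral (fun z => (T%:R^-1)%:E * (\sum_(t < T) Y t z)%:E)%E); last first.
    move=> z _ /=; rewrite ger0_norm ?EFinM// mulr_ge0 ?invr_ge0// sumr_ge0// => t _.
    by rewrite -lee_fin.
  rewrite ge0_integralZl//.
  - by rewrite iSum -EFinM ltry.
  - exact/measurable_EFinP.
  - by move=> z _; rewrite lee_fin sumr_ge0// => t _; rewrite -lee_fin.
have i2 : D.-integrable setT (EFin \o cst (36 : R)).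
  apply: measurable_bounded_integrable => //.
    by rewrite (le_lt_trans (probability_le1 _ _))// ltry.
  exact: bounded_cst.
have -> : (\int[D]_z (EFin \o X') z
    = \int[D]_z ((T%:R^-1 * \sum_(t < T) Y t z)%:E - (cst 36 z)%:E))%E by [].
rewrite integralB_EFin//= integral_cst//.
rewrite [X in (_ - _ * X)%E](_ : _ = 1%E) ?mule1; last exact: probability_setT.
under eq_integral do rewrite EFinM.
rewrite ge0_integralZl//.
- by rewrite iSum -EFinM -EFinB.
- exact/measurable_EFinP.
- by move=> z _; rewrite lee_fin sumr_ge0// => t _; rewrite -lee_fin.
Qed.

(** A prediction in [0, 1] loses at most 1 and the comparator's loss is subtracted. This settles
    [T < d], where the rate is at least 1. *)
Lemma cmp_le1 w : cmp theta w <= 1.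
Proof.
have TR : 0 < T%:R :> R by rewrite ltr0n.
rewrite /cmp lerBlDr ler_pdivrMl//.
have -> : T%:R * (1 + 36) = \sum_(t < T) (1 + 36) :> R.
  by rewrite sumr_const card_ord mulr_natl.
apply: ler_sum => t _.
have /andP[_ h] := risk_itv D mpred (@measurable_ell _ _ _ theta)
  (fun i u => ell_itv i u N0 adm) (unzip1 (H t w)) (rn t w).
by apply: le_trans h _; lra.
Qed.

Variables (g : 'I_N.+1 -> 'cV[R]_d).
Hypothesis admg : forall i, admissible (g i).
Hypothesis close : forall i x, contexts x ->
  `|dot (theta i) (vec x) - dot (g i) (vec x)| <= T%:R^-1.

Let TR : 0 < T%:R :> R. Proof. by rewrite ltr0n. Qed.

Lemma risk_close h e :
  risk D pred (ell theta) h e <= risk D pred (ell g) h e + 12 * T%:R^-1.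
Proof.
have K1 i u := ell_itv i u N0 adm; have K2 i u := ell_itv i u N0 admg.
rewrite -lee_fin EFinD -(riskE D mpred (@measurable_ell _ _ _ theta) K1).
rewrite -(riskE D mpred (@measurable_ell _ _ _ g) K2).
have m1 := measurable_loss_section mpred (@measurable_ell _ _ _ theta) (in_tuple h) e.
have m2 := measurable_loss_section mpred (@measurable_ell _ _ _ g) (in_tuple h) e.
have eta0 : 0 <= 12 * T%:R^-1 :> R by rewrite mulr_ge0// invr_ge0.
have p1 z : (0 <= (ell theta (pred h e z.1) z)%:E)%E.
  by rewrite lee_fin; have /andP[] := K1 (pred h e z.1) z.
have p2 z : (0 <= (ell g (pred h e z.1) z)%:E)%E.
  by rewrite lee_fin; have /andP[] := K2 (pred h e z.1) z.
apply: (@le_trans _ _ (\int[D]_z ((ell g (pred h e z.1) z)%:E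
    + cst (12 * T%:R^-1)%:E z))%E).
  apply: ge0_le_integral => //; first by apply: emeasurable_funD.
  move=> z _; rewrite /cst -EFinD lee_fin.
  by apply: ell_close; rewrite ?invr_ge0.
rewrite ge0_integralD//.
rewrite integral_cst// [X in (_ + _ * X)%E](_ : _ = 1%E) ?mule1//.
exact: probability_setT.
Qed.

Lemma avg_close h u :
  avg rho pred (ell g) h u <= avg rho pred (ell theta) h u + 12 * T%:R^-1.
Proof.
have := sum_wt rho mpred h u.1 => w1.
have -> : 12 * T%:R^-1 = \sum_i wt rho pred h u.1 i * (12 * T%:R^-1).
  by rewrite -mulr_suml w1 mul1r.
rewrite -big_split/=; apply: ler_sum => i _.
rewrite -mulrDr ler_wpM2l ?wt_ge0//; apply: ell_close; rewrite ?invr_ge0//.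
by move=> j x cx; rewrite distrC; exact: close.
Qed.

(** The net point [g] serves the martingale only; the regret bound is applied to [theta], since [g]
    may leave the ball. Passing from [theta] to [g] in the risks and back in the averaged losses
    costs 12 each time, hence 24. *)
Lemma cmp_le w (e : R) : (forall t : 'I_T, contexts (S t w).1) ->
  cumul (dev D rho pred (ell g)) (H T w) <= e ->
  cmp theta w <= T%:R^-1 * (e + 24 + T%:R / (4 * N%:R ^+ 2)
    + (N%:R + 1) * (8 * 640 + 320 * (d%:R * ln (d%:R * (1 + T%:R))))).
Proof.
move=> Sctx He.
have Hin n v : List.In v (H n w) -> contexts v.1.1.
  by elim: n => [//|n ih] /= [<-|//]; exact: Sctx.
have Hin1 n v : List.In v (unzip1 (H n w)) -> contexts v.1.
  by elim: n => [//|n ih] /= [<-|//]; exact: Sctx.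
have h1 : \sum_(t < T) risk D pred (ell theta) (unzip1 (H t w)) (rn t w)
   <= \sum_(t < T) risk D pred (ell g) (unzip1 (H t w)) (rn t w) + 12.
  have -> : 12 = \sum_(t < T) (12 * T%:R^-1) :> R.
    by rewrite sumr_const card_ord -mulr_natl; field; rewrite gt_eqF.
  by rewrite -big_split/=; apply: ler_sum => t _; exact: risk_close.
pose F (h : seq (sample R d * E)) (v : sample R d * E) :=
  risk D pred (ell g) (unzip1 h) v.2.
have h2 : \sum_(t < T) risk D pred (ell g) (unzip1 (H t w)) (rn t w)
   = cumul F (H T w) by rewrite cumul_hist.
pose G (h : seq (sample R d * E)) (v : sample R d * E) :=
  avg rho pred (ell g) (unzip1 h) v.1.
have h3 : cumul F (H T w) = cumul (dev D rho pred (ell g)) (H T w) + cumul G (H T w).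
  rewrite -cumulD; congr cumul; apply/funext => h; apply/funext => v.
  by rewrite /dev /G /F subrK.
pose L (h : seq (sample R d)) (z : sample R d) := \sum_i weights h z.1 i 0 *
  ((grid R N i - z.2%:R) ^+ 2 - (dot (theta i) (vec z.1) - z.2%:R) ^+ 2).
have h4 : cumul G (H T w) <=
    cumul (fun h v => L (map fst h) (fst v) + (36 + 12 * T%:R^-1)) (H T w).
  apply: le_cumul => h v /Hin cv; rewrite /G.
  apply: le_trans (avg_close _ _) _; rewrite addrA lerD2r.
  have -> : 36 = \sum_i wt rho pred (unzip1 h) v.1.1 i * 36.
    by rewrite -mulr_suml (sum_wt rho mpred) mul1r.
  rewrite /L -big_split/=.
  apply: ler_sum => i _; rewrite ell_context// wtE// mulrDr addrC.
  exact: lexx.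
rewrite cumulD (cumul_map fst L) cumul_const size_tuple in h4.
have := swap_regret fcst d0 N0 (theta := theta) (h := map fst (H T w)) bth.
rewrite size_map size_tuple => h5.
have {}h5 := h5 (@Hin1 T).
have h6 : T%:R * (36 + 12 * T%:R^-1) = 36 * T%:R + 12 :> R by field; rewrite gt_eqF.
rewrite h6 in h4.
rewrite /cmp -[36](mulKf (lt0r_neq0 TR)) -mulrBr ler_wpM2l ?invr_ge0//.
rewrite -(natr1 N) in h5; rewrite -/(unzip1 _) in h5 h4.
have : cumul L (map fst (H T w)) <= T%:R / (4 * N%:R ^+ 2)
   + (N%:R + 1) * (8 * 640 + 320 * (d%:R * ln (d%:R * (1 + T%:R)))) by exact: h5.
lra.
Qed.

End Comparator.

Lemma Flin4_choice (f : 'I_N.+1 -> d.-tuple R -> R) : (forall v, @Flin4 R d (f v)) ->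
  exists2 theta : 'I_N.+1 -> 'cV[R]_d, forall i, ball4 (theta i) &
    f = fun v x => dot (theta v) (vec x).
Proof.
move=> Ff.
have /choice[theta th] : forall v, exists th : 'cV[R]_d,
    ball4 th /\ f v = fun x => dot th (vec x).
  move=> v; have [[th fE] f4] := Ff v; exists th; split=> //.
  by apply: Flin4_ball4 => // x cx; have := f4 x cx; rewrite fE.
by exists theta => [i|]; [case: (th i)|apply/funext => v; case: (th v)].
Qed.

Lemma SAErr_le w (c : R) :
  (forall theta : 'I_N.+1 -> 'cV[R]_d, (forall i, ball4 (theta i)) ->
    cmp theta w <= c) ->
  (SAErr (@Flin4 R d) D (predictors pred (S^~ w) (r^~ w)) <= c%:E)%E.
Proof.
move=> h; apply: ge_ereal_sup => _ [f Ff ->].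
have [theta bth ->] := Flin4_choice Ff.
by rewrite expectation_swap_loss// lee_fin h.
Qed.

Lemma SAErr_le1 w : (SAErr (@Flin4 R d) D (predictors pred (S^~ w) (r^~ w)) <= 1)%E.
Proof. by apply: SAErr_le => theta bth; exact: cmp_le1. Qed.

Lemma union_bound (I : finType) (A : I -> set Omega) (p : R) :
  (forall i, measurable (A i)) -> (forall i, (P (A i) <= p%:E)%E) ->
  measurable (\bigcup_i A i) /\ (P (\bigcup_i A i) <= (#|I|%:R * p)%:E)%E.
Proof.
move=> mA pA.
have -> : \bigcup_i A i = \big[setU/set0]_(i <- enum I) A i.
  by rewrite -bigcup_seq; apply/seteqP; split => w [i _ Ai]; exists i => //=;
    rewrite mem_enum.
rewrite cardT; elim: (enum I) => [|i s [m ih]].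
  by rewrite big_nil measure0 mul0r; split.
rewrite big_cons /= -natr1 mulrDl mul1r; split; first exact: measurableU.
apply: le_trans (measureU2 _ (mA i) m) _.
rewrite addeC EFinD; apply: leeD; [exact: ih|exact: pA].
Qed.

(** [W] is the logarithm of the net size divided by [delta], [e] the deviation at which Azuma's
    exponent equals [W], and [8 * d * T] the number of grid steps for which the net has precision
    [1 / T]. *)
Lemma SAErr_whp (delta : R) : 0 < delta < 1 ->
  let W := (N%:R + 1) * d%:R * ln (8 * d * T).+1%:R + ln (1 / delta) in
  let e := Num.sqrt (8 * T%:R * 37 ^+ 2 * W) in
  with_prob_ge P (1 - delta) [set w |
    (SAErr (@Flin4 R d) D (predictors pred (S^~ w) (r^~ w)) <=
      (T%:R^-1 * (e + 24 + T%:R / (4 * N%:R ^+ 2)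
       + (N%:R + 1) * (8 * 640 + 320 * (d%:R * ln (d%:R * (1 + T%:R))))))%:E)%E].
Proof.
move=> /andP[del0 del1]; set M := (8 * d * T)%N => W e.
have TR : 0 < T%:R :> R by rewrite ltr0n.
have lam0 : 0 < ln (1 / delta).
  by rewrite ln_gt0// ltr_pdivlMr// mul1r.
have W0 : 0 < W.
  by rewrite ltr_wpDl// mulr_ge0 ?ln_ge0 ?ler1n// mulr_ge0// addr_ge0.
have Y0 : 0 < 8 * T%:R * 37 ^+ 2 * W by rewrite !mulr_gt0// exprn_gt0.
have e0 : 0 < e by rewrite sqrtr_gt0.
pose K : finType := {ffun 'I_N.+1 * 'I_d -> 'I_M.+1}.
pose bad (k : K) := [set w | e < cumul (dev D rho pred (ell (net k))) (H T w)].
(* Null events, discarded so that the pathwise regret bound applies to every remaining path. *)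
pose off (t : 'I_T) := S t @^-1` (~` [set z : sample R d | contexts z.1]).
have ellK (k : K) i u := @ell_itv R d N (net k) i u N0 (@net_admissible R d N M k).
have mdev (k : K) n := measurable_dev D rho mpred (@measurable_ell R d N (net k))
  (ellK k) (n := n).
have mbad k : measurable (bad k).
  have mX : measurable_fun setT
      (fun w => cumul (dev D rho pred (ell (net k))) (H T w)).
    exact: (measurableT_comp (measurable_cumul (mdev k) (n := T))
      (measurable_hist mSn mrn (n := T))).
  rewrite (_ : bad k = (fun w => cumul (dev D rho pred (ell (net k))) (H T w))
      @^-1` `]e, +oo[%classic).
    by rewrite -[_ @^-1` _]setTI; exact: mX.
  by apply/seteqP; split => w /=; rewrite in_itv/= andbT.
have pbad k : (P (bad k) <= (expR (- W))%:E)%E.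
  have := azuma mSn mrn indep (mdev k) (dev_bound D rho mpred
    (@measurable_ell R d N (net k)) (ellK k))
    (dev_centered D rho mpred (@measurable_ell R d N (net k)) (ellK k))
    T0 (ltr0Sn _ _) e0.
  rewrite sqr_sqrtr ?(ltW Y0)//.
  rewrite (_ : 8 * T%:R * 37 ^+ 2 * W / (8 * T%:R * 37 ^+ 2) = W)//.
  by rewrite mulrC mulKf// gt_eqF// !mulr_gt0// exprn_gt0.
have mctx : measurable [set z : sample R d | contexts z.1].
  rewrite (_ : [set z | _] = fst @^-1` @contexts R d)//.
  rewrite -[_ @^-1` _]setTI; apply: measurable_fst => //.
  exact: measurable_contexts.
have moff t : measurable (off t).
  by rewrite /off -[_ @^-1` _]setTI; apply: measurable_funPT => //; exact: measurableC.
have poff t : (P (off t) <= 0%:E)%E.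
  have [lS _ _] := iid.
  have := lS t _ (measurableC mctx); rewrite /distribution/= /pushforward => ->.
  have -> : (D (~` [set z | contexts z.1]) = 1 - D [set z | contexts z.1])%E.
    exact: probability_setC.
  by rewrite Dctx subee.
have [mB pB] := union_bound mbad pbad.
have [mO pO] := union_bound moff poff.
rewrite mulr0 in pO.
have cardE : #|K|%:R * expR (- W) = delta :> R.
  rewrite /K card_ffun card_prod !card_ord natrX.
  rewrite /W opprD expRD -mulrA -natr1 -/M.
  have -> : expR (- ln (1 / delta)) = delta.
    by rewrite div1r lnV ?posrE// opprK lnK.
  have -> : expR (- ((N%:R + 1) * (d%:R * ln (M%:R + 1))))
      = ((M%:R + 1) ^+ (N.+1 * d))^-1 :> R.
    rewrite expRN; congr (_^-1); rewrite mulrA natr1 -natrM expRM_natl lnK//.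
    by rewrite posrE ltr_wpDl.
  by rewrite mulVKf// expf_neq0// gt_eqF// ltr_wpDl.
rewrite cardE in pB.
exists (~` (\bigcup_k bad k `|` \bigcup_t off t)); split.
- by apply: measurableC; exact: measurableU.
- move=> w /= nw; apply: SAErr_le => theta bth.
  have M0 : (0 < M)%N by rewrite !muln_gt0 d0 T0.
  have dM : (8 * d <= M)%N by rewrite leq_pmulr.
  have [k kc] := net_dense M0 dM bth.
  apply: (@cmp_le theta bth (net k)) => //.
  + exact: net_admissible.
  + move=> i x cx; apply: le_trans (kc i x cx) _.
    rewrite /M !natrM; rewrite le_eqVlt; apply/orP; left; apply/eqP; field.
    by rewrite !pnatr_eq0 -!lt0n d0 T0.
  + move=> t; apply: contrapT => nc; apply: nw; right; exists t => //.
  + rewrite leNgt; apply/negP => lt; apply: nw; left; exists k => //.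
- rewrite probability_setC; last exact: measurableU.
  have h : (P (\bigcup_k bad k `|` \bigcup_t off t) <= delta%:E)%E.
    apply: le_trans (measureU2 _ mB mO) _.
    by rewrite -[delta%:E]adde0 leeD.
  rewrite EFinB; exact: leeB.
Qed.

End OnlineToBatch.

Lemma with_prob_ge_sub (R : realType) (dO : measure_display)
    (Omega : measurableType dO) (P : probability Omega R) (q : R)
    (A B : set Omega) :
  A `<=` B -> with_prob_ge P q A -> with_prob_ge P q B.
Proof. by move=> AB [G [mG GA qG]]; exists G; split=> // w /GA /AB. Qed.

(** * Inserting the rounded choice of [N] *)

Section Rate.
Variables (R : realType) (d T N : nat) (lam : R).
Hypotheses (d0 : (0 < d)%N) (dT : (d <= T)%N) (lam0 : 0 <= lam).
Let a : R := (T%:R / d%:R) `^ (1 / 5).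
Hypothesis Na : rounds_to N a.

Lemma rate_le :
  T%:R^-1 * (Num.sqrt (8 * T%:R * 37 ^+ 2
      * ((N%:R + 1) * d%:R * ln (8 * d * T).+1%:R + lam)) + 24
    + T%:R / (4 * N%:R ^+ 2)
    + (N%:R + 1) * (8 * 640 + 320 * (d%:R * ln (d%:R * (1 + T%:R)))))
  <= 2 * 100 * 100 * (1 + ln T%:R) * (a ^- 2 + a ^- 2 * Num.sqrt lam).
Proof.
have dR : 1 <= d%:R :> R by rewrite ler1n.
have dTR : d%:R <= T%:R :> R by rewrite ler_nat.
have TR : 1 <= T%:R :> R by exact: le_trans dTR.
have a5 : a ^+ 5 = T%:R / d%:R by rewrite powR_fifth// divr_ge0.
have a1 : 1 <= a.
  rewrite -(@ler_pXn2r _ 5) ?nnegrE ?powR_ge0// expr1n a5.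
  by rewrite ler_pdivlMr ?mul1r//; lra.
have [N0 hN] := Na; have N1 : 1 <= N%:R :> R by rewrite ler1n.
move: hN; rewrite ltr_norml => /andP[hN1 hN2].
have lnT : 0 <= ln T%:R :> R by rewrite ln_ge0.
have T0 : 0 < T%:R :> R by lra.
have ln8 : ln 8 <= 8 :> R by exact: ln_le_id.
have ln2 : ln 2 <= 2 :> R by exact: ln_le_id.
have TT : d%:R * T%:R <= T%:R ^+ 2 :> R by rewrite expr2 ler_wpM2r// ltW.
have TT1 : 1 <= T%:R ^+ 2 :> R by rewrite exprn_ege1.
have lnTT : ln (T%:R ^+ 2) = 2 * ln T%:R :> R by rewrite lnXn// mulr_natl.
have lM : 0 <= ln ((8 * d * T).+1%:R : R) <= 8 * (1 + ln T%:R).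
  rewrite ln_ge0 ?ler1n//=.
  have h : ln (8 * d * T).+1%:R <= ln (9 * T%:R ^+ 2) :> R.
    rewrite ler_ln ?posrE ?ltr0n// ?mulr_gt0 ?exprn_gt0//.
    rewrite -natr1 !natrM -mulrA; lra.
  have ln9 : ln 9 <= 8 :> R.
    have := @le_ln1Dx R 8; rewrite (_ : 1 + 8 = 9); last by ring.
    by apply; lra.
  have e : ln (9 * T%:R ^+ 2) = ln 9 + 2 * ln T%:R :> R.
    by rewrite -lnTT; apply: lnM; rewrite posrE// exprn_gt0.
  lra.
have ld : 0 <= ln (d%:R * (1 + T%:R) : R) <= 2 * (1 + ln T%:R).
  have p : 1 <= d%:R * (1 + T%:R) :> R.
    by rewrite -[leLHS]mulr1; apply: ler_pM => //; lra.
  rewrite ln_ge0//=.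
  have h : ln (d%:R * (1 + T%:R)) <= ln (2 * T%:R ^+ 2) :> R.
    rewrite ler_ln ?posrE; [|lra|by rewrite mulr_gt0// exprn_gt0].
    have : d%:R * 1 <= T%:R * T%:R :> R by apply: ler_pM; lra.
    rewrite expr2 in TT *; lra.
  have e : ln (2 * T%:R ^+ 2) = ln 2 + 2 * ln T%:R :> R.
    by rewrite -lnTT; apply: lnM; rewrite posrE// exprn_gt0.
  lra.
have a0 : 0 < a by lra.
have d00 : 0 < d%:R :> R by lra.
(* Rounding [N] costs only constants: [N + 1 < a + 2 <= 3 a] and [a < N + 1 <= 2 N]. *)
have := @error_terms_le R a^-1 T%:R^-1 N%:R d%:R lam (1 + ln T%:R)
  (ln (8 * d * T).+1%:R) (ln (d%:R * (1 + T%:R))).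
rewrite !invrK !exprVn; apply => //.
- by rewrite invr_gt0 a0 invf_le1.
- by rewrite invr_gt0.
- by rewrite a5 invf_div.
- by rewrite a5 invf_div -[leLHS]mul1r ler_wpM2r// invr_ge0 ltW.
- by rewrite ler_pdivrMr//; lra.
- by rewrite ler_pdivlMr//; lra.
- lra.
Qed.

End Rate.

Theorem theorem5 (R : realType) :
  exists (C C' : R) (k k' : nat),
  forall (d T N : nat) (delta : R)
    (D : probability (d.-tuple R * bool)%type R)
    (theta1 : 'I_N.+1 -> 'cV[R]_d)
    (weights : seq (d.-tuple R * bool) -> d.-tuple R -> 'cV[R]_N.+1)
    (dE : measure_display) (E : measurableType dE) (rho : probability E R)
    (pred : seq (d.-tuple R * bool) -> E -> d.-tuple R -> 'I_N.+1)
    (dO : measure_display) (Omega : measurableType dO)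
    (P : probability Omega R)
    (S : 'I_T -> {RV P >-> (d.-tuple R * bool)%type})
    (r : 'I_T -> {RV P >-> E}),
  (0 < d)%N -> (0 < T)%N -> 0 < delta < 1 ->
  D [set z | contexts z.1] = 1%E ->
  rounds_to N ((T%:R / d%:R : R) `^ (1 / 5)) ->
  is_forecaster theta1 weights ->
  is_sampler weights rho pred ->
  iid_fresh D rho S r ->
  let err (w : Omega) : \bar R :=
    SAErr (@Flin4 R d) D (predictors pred (S^~ w) (r^~ w)) in
  let rate : R := (d%:R / T%:R) `^ (2 / 5) in
  with_prob_ge P (1 - delta)
    [set w | (err w <= (C * (1 + ln T%:R) ^+ k
                        * (rate + rate * Num.sqrt (ln (1 / delta))))%:E)%E]
  /\
  (forall eps : R, 0 < eps < 1 ->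
     C' * (1 + ln (d%:R / (eps * delta))) ^+ k' * (d%:R * eps `^ (- (5 / 2)))
       <= T%:R ->
     with_prob_ge P (1 - delta) [set w | (err w <= eps%:E)%E]).
Proof.
pose C : R := 2 * 100 * 100.
(* The sample size condition is the fifth power of [32 * C * L * b <= a], where [a ^+ 5 = T / d] and
   [b] is [eps] to the power -1/2. *)
exists C, ((32 * C) ^+ 5), 1%N, 5%N.
move=> d T N delta D theta1 weights dE E rho pred dO Omega P S r.
move=> d0 T0 hdel Dctx hN fcst smp iid err rate.
have /andP[del0 del1] := hdel.
have dR : 1 <= d%:R :> R by rewrite ler1n.
have TR : 1 <= T%:R :> R by rewrite ler1n.
have N0 : (0 < N)%N := hN.1.
set lam := ln (1 / delta); pose a : R := (T%:R / d%:R) `^ (1 / 5).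
have lam0 : 0 <= lam by rewrite ln_ge0// ler_pdivlMr// mul1r ltW.
have TdR : 0 < T%:R / d%:R :> R by rewrite divr_gt0//; lra.
have a5 : a ^+ 5 = T%:R / d%:R by rewrite powR_fifth// ltW.
have a0 : 0 < a by rewrite powR_gt0.
have rateE : rate = a ^- 2 by rewrite /rate -powR_two_fifths// invf_div.
have s0 := sqrtr_ge0 lam.
have lnT : 0 <= ln T%:R :> R by rewrite ln_ge0.
have C1 : 1 <= C by rewrite /C; lra.
have part1 : with_prob_ge P (1 - delta)
    [set w | (err w <= (C * (1 + ln T%:R) ^+ 1
                        * (rate + rate * Num.sqrt lam))%:E)%E].
  (* For [T < d] the bound is at least 1 and holds on every sample path. *)
  rewrite rateE expr1; have [dT|Td] := leqP d T.
    apply: with_prob_ge_sub (SAErr_whp d0 T0 N0 Dctx fcst smp iid hdel) => w /=.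
    by move=> h; apply: le_trans h _; rewrite lee_fin; exact: rate_le.
  exists setT; split => //; last by rewrite probability_setT lee_fin; lra.
  move=> w _ /=.
  apply: le_trans (SAErr_le1 S r d0 T0 N0 Dctx smp w) _; rewrite lee_fin.
  have a1 : a <= 1.
    rewrite -(@ler_pXn2r _ 5) ?nnegrE ?(ltW a0)// expr1n a5.
    by rewrite ler_pdivrMr ?mul1r ?ler_nat ?(ltnW Td)//; lra.
  have q1 : 1 <= a ^- 2 by rewrite invf_ge1 ?exprn_gt0// exprn_ile1// ltW.
  rewrite -[leLHS](mulr1 1); apply: ler_pM => //.
    by rewrite -[leLHS](mulr1 1); apply: ler_pM => //; lra.
  by rewrite (le_trans q1)// lerDl mulr_ge0//; lra.
split=> // eps /andP[eps0 eps1] hT.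
apply: with_prob_ge_sub part1 => w /= h; apply: le_trans h _.
rewrite lee_fin rateE expr1.
pose b : R := eps `^ (- (1 / 2)).
set L := 1 + ln (d%:R / (eps * delta)) in hT.
have ed0 : 0 < eps * delta by rewrite mulr_gt0.
have lnL : L = 1 + ln d%:R + ln (1 / eps) + lam.
  rewrite /L /lam !div1r !lnV ?posrE//.
  have e1 : ln (d%:R / (eps * delta)) = ln d%:R + ln (eps * delta)^-1.
    by apply: lnM; rewrite posrE ?invr_gt0//; lra.
  have e2 : ln (eps * delta) = ln eps + ln delta by apply: lnM; rewrite posrE.
  have e3 : ln (eps * delta)^-1 = - ln (eps * delta) by rewrite lnV// posrE.
  by rewrite e1 e3 e2 opprD !addrA.
have lnd : 0 <= ln d%:R :> R by rewrite ln_ge0.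
have lne : 0 <= ln (1 / eps) by rewrite ln_ge0// ler_pdivlMr// mul1r ltW.
have epsE : b ^- 2 = eps by rewrite powR_half_sqr.
have b0 : 0 < b by rewrite powR_gt0.
have b1 : 1 <= b.
  rewrite -(@ler_pXn2r _ 2) ?nnegrE ?(ltW b0)// expr1n.
  by rewrite -[b ^+ 2]invrK epsE invf_ge1// ltW.
have lnb : ln b <= ln (1 / eps).
  rewrite ler_ln ?posrE ?divr_gt0// -epsE div1r invrK expr2.
  by rewrite ler_peMl// ltW.
(* [T = d * a ^+ 5], so the logarithmic factor grows with [a] itself; absorbing it is the task of
   [sample_size_le]. *)
have lnTE : ln T%:R = ln d%:R + 5 * ln a.
  have e1 : ln (T%:R / d%:R) = ln T%:R - ln d%:R :> R.
    by rewrite -[in RHS]lnV ?posrE; [apply: lnM; rewrite posrE ?invr_gt0; lra|lra].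
  have : ln (a ^+ 5) = 5 * ln a by rewrite lnXn// mulr_natl.
  by rewrite a5 e1 => <-; ring.
rewrite -epsE; apply: (@sample_size_le R C a b L (1 + ln T%:R) lam) => //.
- lra.
- lra.
- by apply/andP; split => //; lra.
- lra.
- have q0 : 0 <= 32 * C * L * b.
    by apply: mulr_ge0; [apply: mulr_ge0; [apply: mulr_ge0|]|]; lra.
  rewrite -(@ler_pXn2r _ 5) ?nnegrE ?(ltW a0)// a5 ler_pdivlMr; last lra.
  apply: le_trans hT; rewrite powR_half_pow5 ?(ltW eps0)// -/b !exprMn.
  by rewrite -[leLHS]mulrA (mulrC (b ^+ 5)).
Qed.
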